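(* Let $k>2$ and let $sc_k=(k,k-1,\ldots,1)$. For every $S\in SYT(sc_k)$, $\mathrm{Des}_e(S)=\mathrm{Des}_e(\iota(S))$, where the left-hand side is the descent vector of the staircase tableau $S$, the right-hand side is the descent vector of the rectangular tableau $\iota(S)\in SYT(k^{(k+1)})$ (both are arrays of $k(k+1)$ boxes, each dotted or empty), and $\iota$ is the embedding defined in the context.
   Context: Tableaux are in English notation; box $(i,j)$ is in row $i$ from the top and column $j$ from the left, and $T[i,j]$ is the entry of $T$ in that box. $SYT(\lambda)$ is the set of standard Young tableaux of shape $\lambda$. $c^r$ is the rectangular partition $(c,\ldots,c)$ with $r$ parts, so $k^{(k+1)}$ has $k+1$ rows and $k$ columns. Promotion: for $T\in SYT(\lambda)$ with $|\lambda|=m$, remove the entry $m$ from its box, leaving it empty. Repeatedly move into the empty box the larger of the entries directly north and directly west of it (or the only one present), so the empty box moves to the position of that entry, until the empty box reaches $(1,1)$. This process is called sliding. Then put $0$ in the empty box and add $1$ to every entry. The result is $\partial(T)\in SYT(\lambda)$. Evacuation: for $T\in SYT(\lambda)$ with $|\lambda|=m$, put $T_0=T$, $\lambda_0=\lambda$. For $k=0,1,\ldots,m-1$: in $T_k$ (a filling of the skew shape $\lambda_k$) remove the largest entry, leaving its box empty, and repeatedly move into the empty box the larger of the entries in the boxes of $\lambda_k$ directly north and directly west of it (or the only one present), so the empty box moves to the position of that entry, until no box of $\lambda_k$ lies directly north or west of it; let $(i_k,j_k)$ be its final position. Set $\epsilon(T)[i_k,j_k]=k+1$. Delete box $(i_k,j_k)$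 to obtain $\lambda_{k+1}$ and $T_{k+1}$. This defines $\epsilon(T)\in SYT(\lambda)$. Embedding $\iota$: for $S\in SYT(sc_k)$ let $N=k(k+1)$. The tableau $R=\iota(S)\in SYT(k^{(k+1)})$ is given, for $1\le i\le k+1$, $1\le j\le k$, by $R[i,j]=S[i,j]$ if $i+j\le k+1$, and $R[i,j]=N+1-\epsilon(S)[k+2-i,\,k+1-j]$ if $i+j>k+1$. Descents: $i$ is a descent of $T\in SYT(\lambda)$ if $i+1$ appears in a row strictly south of (below) the row of $i$; $\mathrm{Des}(T)$ is the set of descents. Descent vector, rectangular case: if $R$ is a standard tableau of rectangular shape with $m$ boxes, $\mathrm{Des}_e(R)$ is an array of $m$ boxes; for $1\le i\le m-1$ the $i$-th box is dotted iff $i\in\mathrm{Des}(R)$, and the $m$-th box is dotted iff $1\in\mathrm{Des}(\partial(R))$. Descent vector, staircase case: if $S\in SYT(sc_k)$ and $n=k(k+1)/2$, $\mathrm{Des}_e(S)$ is an array of $2n$ boxes. For $1\le i\le n-1$: if $i\in\mathrm{Des}(S)$ the $i$-th box is dotted and the $(n+i)$-th is empty; otherwise the $(n+i)$-th box is dotted and the $i$-th is empty. If $1\in\mathrm{Des}(\partial(S))$ the $n$-th box is empty and the $2n$-th is dotted; otherwise the $n$-th box is dotted and the $2n$-th is empty. *)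

(* Defs.v *)
From mathcomp Require Import all_boot.

Set Implicit Arguments.
Unset Strict Implicit.
Unset Printing Implicit Defensive.

(** Boxes are pairs (row, column), both counted from 1.  A filling is a total
    function on boxes; only its values on the boxes of the shape at hand are
    meaningful. *)
Definition box : Type := (nat * nat)%type.
Definition filling : Type := box -> nat.

Definition boxes (la : seq nat) : seq box :=
  [seq (i, j) | i <- iota 1 (size la), j <- iota 1 (nth 0 la i.-1)].

Definition staircase (k : nat) : seq nat := [seq k - i | i <- iota 0 k].
Definition rectangle (c r : nat) : seq nat := nseq r c.

Definition SYT (la : seq nat) (T : filling) : Prop :=
  [/\ perm_eq [seq T b | b <- boxes la] (iota 1 (sumn la)),
      forall i j, (i, j) \in boxes la -> (i, j.+1) \in boxes la ->
        T (i, j) < T (i, j.+1)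
    & forall i j, (i, j) \in boxes la -> (i.+1, j) \in boxes la ->
        T (i, j) < T (i.+1, j)].

Definition update (T : filling) (b : box) (v : nat) : filling :=
  fun b' => if b' == b then v else T b'.

(** The box of [D] containing [v]; (0, 0), which is never a box, if none does. *)
Definition box_of (D : seq box) (T : filling) (v : nat) : box :=
  nth (0, 0) D (index v [seq T b | b <- D]).

(** [slide s D T h] slides the empty box [h] of the skew shape [D] until it has
    no neighbour in [D] to the north or west, and returns its final position
    with the resulting filling, whose value at that position is irrelevant.
    The number of steps is capped by [s]; since each step decreases the sum of
    the coordinates of [h], the cap [h.1 + h.2] is never reached. *)
Fixpoint slide (s : nat) (D : seq box) (T : filling) (h : box)
    : box * filling :=
  if s is s'.+1 then
    let north := (h.1.-1, h.2) in
    let west := (h.1, h.2.-1) in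
    let move b := slide s' D (update T h (T b)) b in
    match north \in D, west \in D with
    | true, true => if T west < T north then move north else move west
    | true, false => move north
    | false, true => move west
    | false, false => (h, T)
    end
  else (h, T).

Definition slide_from (D : seq box) (T : filling) (h : box) : box * filling :=
  slide (h.1 + h.2) D T h.

Definition promotion (la : seq nat) (T : filling) : filling :=
  let D := boxes la in
  let: (h, T') := slide_from D T (box_of D T (sumn la)) in
  fun b => (update T' h 0 b).+1.

(** [s] is the number of steps left, [k] the number of steps done, [D] and [T]
    the current skew shape and its filling, [E] the part of the evacuation
    recorded so far. *)
Fixpoint evacuation_rec (s k : nat) (D : seq box) (T E : filling) : filling :=
  if s is s'.+1 then
    let largest := foldr maxn 0 [seq T b | b <- D] in
    let: (h, T') := slide_from D T (box_of D T largest) in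
    evacuation_rec s' k.+1 (rem h D) T' (update E h k.+1)
  else E.

Definition evacuation (la : seq nat) (T : filling) : filling :=
  evacuation_rec (sumn la) 0 (boxes la) T (fun=> 0).

(** The embedding of SYT(sc_k) into SYT(k^(k+1)). *)
Definition embedding (k : nat) (S : filling) : filling := fun b =>
  let: (i, j) := b in
  if i + j <= k + 1 then S (i, j)
  else k * (k + 1) + 1 - evacuation (staircase k) S (k + 2 - i, k + 1 - j).

Definition Des (la : seq nat) (T : filling) : pred nat :=
  [pred i | has (fun b => has (fun b' =>
     [&& T b == i, T b' == i.+1 & b.1 < b'.1]) (boxes la)) (boxes la)].

(** Descent vectors are sequences of booleans, [true] meaning dotted; the
    [i]-th box, counted from 1, is the item of index [i.-1]. *)
Definition rect_descent_vector (c r : nat) (R : filling) : seq bool :=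
  let la := rectangle c r in
  let m := c * r in
  [seq if i < m then i \in Des la R else 1 \in Des la (promotion la R)
  | i <- iota 1 m].

Definition stair_descent_vector (k : nat) (S : filling) : seq bool :=
  let la := staircase k in
  let n := (k * (k + 1)) %/ 2 in
  [seq if i < n then i \in Des la S
       else if i == n then 1 \notin Des la (promotion la S)
       else if i < 2 * n then i - n \notin Des la S
       else 1 \in Des la (promotion la S)
  | i <- iota 1 (2 * n)].

(* Main.v *)
Require Import Defs.
From mathcomp Require Import all_boot.
From mathcomp Require Import zify.

Set Implicit Arguments.
Unset Strict Implicit.
Unset Printing Implicit Defensive.

(** Write a standard tableau as the word [W] of its boxes, largest entry first.
    Sliding reads this word from left to right: the hole [h] meets the letters one
    after the other, and moves to the letter [x] (whose entry moves to [h]) exactly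
    if [x] is the north or west neighbour of [h].  So promotion is a sequence of
    exchanges of adjacent letters.  The final holes of the successive slides of an
    evacuation form a word [E], and the word of the embedded tableau is [E], turned
    by 180 degrees, followed by [W].

    Let n be the number of boxes of the staircase.  The boxes 1 to n - 1 of the
    descent vectors agree because the entries up to n of the embedded tableau are
    those of S.  For the boxes n + 1 to 2n - 1 one needs that evacuation of a
    staircase tableau complements descents ([evac_word_descents]): the two largest
    entries are in different corners, and the slides that start there keep their
    order from start to end.

    The boxes n and 2n rest on a theorem of Edelman and Greene
    ([corner_transpose]): n promotions move the largest entry to the transposed
    corner.  Let r_0, r_1, r_2 and so on be the rows of the largest entries of S
    and of its successive promotions.  The product of the n adjacent transpositions
    with indices r_0 to r_(n-1) does not depend on S.  Indeed an elementary dual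
    equivalence on three consecutive entries commutes with slides ([dual_slid],
    [dual_slid3]), and once the three entries are the largest ones it changes the
    word of the r_j by a commutation or a braid relation ([dual_act_word]); and all
    tableaux of a straight shape are connected by such equivalences
    ([act_word_const]).  Comparing S with its promotion, the common permutation
    conjugates the transposition of index r_0 into that of index r_n.  It thus maps
    neighbours to neighbours, so it is the identity or the reversal of the points
    1 to k + 1.  If n is at the foot of the first column, its slide runs straight
    up this column, which forces r_n to be smaller than r_(n-1) and excludes the
    identity.  Hence r_n = k + 1 - r_0.

    The corner of row r_n, turned by 180 degrees, is the box just below the entry n
    of S.  This box is also where the slide of the embedded tableau leaves the
    turned part ([promote_rect_word]); so the hole moves on to the box of n and then
    follows the slide of S, which gives box 2n.  Box n compares r_n with r_(n-1),
    once through the last two letters of the promotion and once through the last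
    letter of [E] ([promote_descent]). *)

(** * Slides on words of boxes *)

Definition nwle (x y : box) : bool := (x.1 <= y.1) && (x.2 <= y.2).

(** The two positions from which an entry can move into an empty box [y]. *)
Definition nwcover (x y : box) : bool :=
  (x.1.+1 == y.1) && (x.2 == y.2) || (x.1 == y.1) && (x.2.+1 == y.2).

(** A tableau is encoded by the word of its boxes, largest entry first.  An empty
    box [h] travels through the word [s] of the remaining entries: the first
    letter that is a neighbour of [h] to the north or west carries the larger of
    the two candidate entries, so trying the letters one by one is the sliding
    rule. *)
Fixpoint slid (h : box) (s : seq box) : seq box :=
  if s is x :: s' then
    if nwcover x h then h :: slid x s' else x :: slid h s'
  else [::].

Fixpoint hole_end (h : box) (s : seq box) : box :=
  if s is x :: s' then if nwcover x h then hole_end x s' else hole_end h s'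
    else h.

Definition convex (W : seq box) : Prop :=
  forall x y z : box, x \in W -> y \in W -> nwle x z -> nwle z y -> z \in W.

(** A letter that stands earlier carries a larger entry.  Reflexivity of [nwle]
    makes the letters distinct. *)
Definition linext (W : seq box) : bool :=
  pairwise (fun y x : box => ~~ nwle y x) W.

(** Convex sets of boxes are the skew shapes, so these are the words of the
    standard fillings of skew shapes. *)
Definition skew_word (W : seq box) : Prop := linext W /\ convex W.

Lemma nwle_refl x : nwle x x.
Proof. by rewrite /nwle !leqnn. Qed.

Lemma box_eqP (x y : box) : x.1 = y.1 -> x.2 = y.2 -> x = y.
Proof. by case: x y => [a b] [c d] /= -> ->. Qed.

Lemma linext_cat u v :
  linext (u ++ v) = [&& allrel (fun y x : box =>
    ~~ nwle y x) u v, linext u & linext v].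
Proof. exact: pairwise_cat. Qed.

Lemma linext_cons h s : linext (h :: s) = all (fun x : box =>
    ~~ nwle h x) s && linext s.
Proof. by []. Qed.

Lemma skew_word_cat u v : skew_word (u ++ v) -> skew_word u /\ skew_word v.
Proof.
case; rewrite linext_cat => /and3P[/allrelP uv lu lv] cv; split; split=> //.
  move=> x y z xu yu xz zy; have: z \in u ++ v.
    by apply: (cv x y) => //; rewrite mem_cat ?xu ?yu.
  by rewrite mem_cat => /orP[//|zv]; move: (uv x z xu zv); rewrite xz.
move=> x y z xu yu xz zy; have: z \in u ++ v.
  by apply: (cv x y) => //; rewrite mem_cat ?xu ?yu orbT.
by rewrite mem_cat => /orP[zv|//]; move: (uv z y zv yu); rewrite zy.
Qed.

Lemma skew_word_perm W W' : perm_eq W W' -> linext W' -> skew_word W ->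
    skew_word W'.
Proof.
move=> p l [_ c]; split=> // x y z; rewrite -!(perm_mem p); exact: c.
Qed.

Lemma skew_word_behead h s : skew_word (h :: s) -> skew_word s.
Proof. by rewrite -cat1s => /skew_word_cat[]. Qed.

Lemma skew_word_north W (x y : box) : skew_word W -> x \in W -> y \in W ->
    nwle x y -> x.1 < y.1 ->
  (y.1.-1, y.2) \in W.
Proof.
move=> [_ c] xW yW xy lt; apply: (c x y) => //; move: xy; rewrite /nwle /=; lia.
Qed.

Lemma skew_word_west W (x y : box) : skew_word W -> x \in W -> y \in W ->
    nwle x y -> x.2 < y.2 ->
  (y.1, y.2.-1) \in W.
Proof.
move=> [_ c] xW yW xy lt; apply: (c x y) => //; move: xy; rewrite /nwle /=; lia.
Qed.

(** Convexity of an explicit word, unfolded into conditions that linear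
    arithmetic can use: if [x] lies weakly north-west of [y] and in a smaller row
    (column), then the north (west) neighbour of [y] is a letter. *)
Fixpoint neighbours_in (W : seq box) : bool :=
  if W is y :: s then
    all (fun x : box => ~~ nwle y x &&
       (nwle x y ==> ((x.1 < y.1) ==> has (fun b : box =>
         (b.1.+1 == y.1) && (b.2 == y.2)) s) &&
                 ((x.2 < y.2) ==> has (fun b : box =>
                   (b.1 == y.1) && (b.2.+1 == y.2)) s))) s
    && neighbours_in s
  else true.

Lemma skew_word_neighbours W : skew_word W -> neighbours_in W.
Proof.
elim: W => [//|y s IH] w /=; rewrite (IH (skew_word_behead w)) andbT.
have := w => -[]; rewrite linext_cons => /andP[/allP nle _] _.
apply/allP => x xs; rewrite nle //=; apply/implyP => xy.
have xW : x \in y :: s by rewrite inE xs orbT.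
have yW : y \in y :: s by rewrite inE eqxx.
apply/andP; split; apply/implyP => lt.
  have := skew_word_north w xW yW xy lt; rewrite inE => /orP[/eqP e|m].
    by move: lt (congr1 fst e) => /=; lia.
  by apply/hasP; exists (y.1.-1, y.2) => //=; lia.
have := skew_word_west w xW yW xy lt; rewrite inE => /orP[/eqP e|m].
  by move: lt (congr1 snd e) => /=; lia.
by apply/hasP; exists (y.1, y.2.-1) => //=; lia.
Qed.

(** A slide only ever exchanges adjacent letters that are not neighbours.  Such
    letters are incomparable: otherwise convexity would give a third letter
    between the two boxes, and it would have to stand between them in the word. *)
Lemma skew_word_swap u h x v : ~~ nwcover x h ->
    skew_word (u ++ h :: x :: v) -> skew_word (u ++ x :: h :: v).
Proof.
move=> nc w; have p : perm_eq (u ++ h :: x :: v) (u ++ x :: h :: v).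
  by rewrite perm_cat2l -(cat1s h) -(cat1s x) perm_catCA.
apply: (skew_word_perm p) => //.
have [_ w2] := skew_word_cat w;
  have := skew_word_neighbours (proj1 (@skew_word_cat [:: h; x] v w2)).
case: w => l _ o; move: l; rewrite !linext_cat !linext_cons !allrel_consr /=.
case/and3P => /and3P[-> -> ->] -> /andP[/andP[hx hv]] /andP[-> ->] /=.
rewrite hv !andbT; move: nc o => /=; rewrite /nwcover /nwle /=;
  case: x h {hx hv w2 p} => a b [c d] /=.
lia.
Qed.

Lemma perm_slide h s : perm_eq (slid h s ++ [:: hole_end h s]) (h :: s).
Proof.
elim: s h => [|x s IH] h //=; case: ifP => _ /=.
  by rewrite perm_cons IH.
rewrite (@perm_trans _ (x :: h :: s)) ?perm_cons ?IH //.
by rewrite -(cat1s x) -(cat1s h) perm_catCA.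
Qed.

Lemma skew_word_slide_cat u h s v : skew_word (u ++ h :: s ++ v) ->
    skew_word (u ++ slid h s ++ hole_end h s :: v).
Proof.
elim: s u h => [|x s IH] u h //= w; case: ifPn => c /=.
  by rewrite -cat_rcons; apply: IH; rewrite cat_rcons.
by rewrite -cat_rcons; apply: IH; rewrite cat_rcons; apply: skew_word_swap.
Qed.

Lemma skew_word_slide h s : skew_word (h :: s) ->
    skew_word (slid h s ++ [:: hole_end h s]).
Proof. by move=> w; apply: (@skew_word_slide_cat [::]); rewrite cats0. Qed.

Lemma skew_word_slid h s : skew_word (h :: s) -> skew_word (slid h s).
Proof. by case/skew_word_slide/skew_word_cat. Qed.

Lemma size_slid h s : size (slid h s) = size s.
Proof. by elim: s h => //= x s IH h; case: ifP => _ /=; rewrite IH. Qed.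

Lemma slid_cat h s t : slid h (s ++ t) = slid h s ++ slid (hole_end h s) t.
Proof. by elim: s h => //= x s IH h; case: ifP => _ /=; rewrite IH. Qed.

Lemma hole_end_cat h s t : hole_end h (s ++ t) = hole_end (hole_end h s) t.
Proof. by elim: s h => //= x s IH h; case: ifP => _ /=; rewrite IH. Qed.

(** * Slides preserve descents *)

(** The descents of the tableau, from the largest entry down. *)
Fixpoint descents (W : seq box) : seq bool :=
  if W is y :: s then if s is x :: _ then (x.1 < y.1) :: descents s else [::]
  else [::].

(** Entries move by at most one step, south or east.  If that changed the order
    of the two rows, the larger neighbour of the hole would have been passed over
    or a 2 by 2 square would lack a corner, against convexity. *)
Lemma descents_slid3 h y x : skew_word [:: h; y; x] -> descents (slid h [:: y;
    x]) = descents [:: y; x].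
Proof.
move=> /skew_word_neighbours; rewrite /neighbours_in /= /nwcover /nwle.
case: h y x => [a b] [c d] [e f] /=.
case: ifP => c1 /=; case: ifP => c2 /= H; congr cons; apply/idP/idP; lia.
Qed.

Lemma descents_slid h s : skew_word (h :: s) ->
    descents (slid h s) = descents s.
Proof.
elim: s h => [//|y s IH] h w.
case: s IH w => [|x s] IH w; first by rewrite /=; case: ifP.
have e3 := @descents_slid3 h y x (proj1 (@skew_word_cat [:: h; y; x] s w)).
have wy := skew_word_behead w.
have IHy := IH y wy.
have wh : ~~ nwcover y h -> skew_word (h :: x :: s).
  by move=> nc; apply: (@skew_word_behead y); apply: (@skew_word_swap [::]).
move: (congr1 (head false) e3) IHy (fun nc => IH h (wh nc)) => /=.
by case: ifPn => c1 /=; case: ifPn => c2 //= e0 e1 e2; rewrite ?e0 ?e1 ?e2.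
Qed.

(** * Elementary dual equivalences commute with slides *)

Inductive swap3 : seq box -> seq box -> Prop :=
| SwapTop z y x : swap3 [:: z; y; x] [:: y; z; x]
| SwapBottom z y x : swap3 [:: z; y; x] [:: z; x; y].

(** An elementary dual equivalence: among three consecutive entries, two that
    are consecutive exchange their boxes, and exactly one of the two consecutive
    pairs is a descent before, the other one after. *)
Definition dual (t t' : seq box) : Prop :=
  swap3 t t' /\ exists d, descents t = [:: d; ~~ d] /\ descents t' = [:: ~~ d;
    d].

Lemma skew_word_nle y z v u : skew_word (u ++ y :: z :: v) -> ~~ nwle y z.
Proof. by case/skew_word_cat=> _ []; rewrite linext_cons => /andP[/andP[]]. Qed.

Lemma nwcover_le x y : nwcover x y -> nwle x y.
Proof. rewrite /nwcover /nwle; lia. Qed.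

Lemma nle_ncover x y : ~~ nwle x y -> nwcover x y = false.
Proof. by move=> n; apply/negP => /nwcover_le; rewrite (negbTE n). Qed.

Lemma nwcover_cases (x y : box) : nwcover x y ->
  (x.1.+1 = y.1 /\ x.2 = y.2) \/ (x.1 = y.1 /\ x.2.+1 = y.2).
Proof. by case/orP=> /andP[/eqP-> /eqP->]; [left | right]. Qed.

(** [z] and [y] are the two neighbours of the hole [h].  The descents put [x] in
    the row of the upper one, and by convexity it is then the box that completes
    the 2 by 2 square. *)
Lemma top_swap_inner (h z y x : box) d : skew_word [:: h; z; y;
    x] -> nwcover z h -> nwcover y h ->
  (y.1 < z.1) = d -> (x.1 < y.1) = ~~ d -> (z.1 < y.1) = ~~ d ->
    (x.1 < z.1) = d ->
  nwcover x z && nwcover x y.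
Proof.
move=> w cz cy.
have zW : z \in [:: h; z; y; x] by rewrite !inE eqxx orbT.
have yW : y \in [:: h; z; y; x] by rewrite !inE eqxx !orbT.
have xW : x \in [:: h; z; y; x] by rewrite !inE eqxx !orbT.
have wW := skew_word_west w xW.
have := w => -[]; rewrite /linext /= !andbT =>
  /and3P[/and3P[_ _ l1] /andP[l2 l3] l4] _.
have := wW _ zW; have := wW _ yW; rewrite !inE /eq_op /=.
case: h z y x cz cy {w zW yW xW wW} l1 l2 l3 l4 =>
  [h1 h2] [z1 z2] [y1 y2] [x1 x2].
move=> /nwcover_cases /= [[e1 e2]|[e1 e2]] /nwcover_cases /= [[e3 e4]|[e3 e4]];
  subst h1 h2;
  try (injection e3 => e3'); try (injection e4 => e4'); subst;
    rewrite /nwcover /nwle /=;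
  rewrite ?eqxx ?ltnn ?leqnn ?ltnS ?leqnSn //.
all: by case: d => //=; lia.
Qed.

(** With [x] and [y] the two neighbours of [h], the descents would put [z] in
    the row of [h] beyond its west neighbour, hence weakly beyond [h]. *)
Lemma bottom_swap_row (h z y x : box) d : skew_word [:: h; z; y;
    x] -> nwcover x h -> nwcover y h ->
  (y.1 < z.1) = d -> (x.1 < y.1) = ~~ d -> (x.1 < z.1) = ~~ d -> False.
Proof.
case=> + _; rewrite /linext /= !andbT.
case: h z y x => [h1 h2] [z1 z2] [y1 y2] [x1 x2] + /nwcover_cases c1
  /nwcover_cases c2.
move: c1 c2; rewrite /nwle /= => -[[e1 e2]|[e1 e2]] [[e3 e4]|[e3 e4]];
  subst h1 h2;
  try (injection e3 => e3'); try (injection e4 => e4'); subst; case: d => //=.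
all: lia.
Qed.

(** Whichever side of [z] the box [h] is on, [h] and one of [x], [y] would be
    opposite corners of a 2 by 2 square with a missing box. *)
Lemma bottom_swap_square (h z y x : box) : skew_word [:: h; z; y;
    x] -> nwcover z h -> nwcover y z -> nwcover x z -> False.
Proof.
move=> w.
have hW : h \in [:: h; z; y; x] by rewrite !inE eqxx.
have yW : y \in [:: h; z; y; x] by rewrite !inE eqxx !orbT.
have xW : x \in [:: h; z; y; x] by rewrite !inE eqxx !orbT.
have := w => -[]; rewrite /linext /= !andbT => /and3P[/and3P[_ _ _] _ l4] _.
have := skew_word_north w xW hW; have := skew_word_north w yW hW.
have := skew_word_west w xW hW; have := skew_word_west w yW hW.
rewrite !inE /eq_op /=.
case: h z y x l4 {w hW yW xW} =>
  [h1 h2] [z1 z2] [y1 y2] [x1 x2] + + + + + /nwcover_cases c1 /nwcover_cases c2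
  /nwcover_cases c3.
move: c1 c2 c3; rewrite /nwle /= =>
  -[[e1 e2]|[e1 e2]] [[e3 e4]|[e3 e4]] [[e5 e6]|[e5 e6]]; subst h1 h2 z1 z2;
  try (injection e5 => e5'); try (injection e6 => e6'); subst;
    rewrite ?leqnn ?ltnn ?andbF //=.
all: lia.
Qed.

(** Slides commute with elementary dual equivalences.  As they preserve descents,
    only the exchange itself has to be followed.  It survives unchanged unless
    both exchanged boxes are neighbours of the hole when it meets them; then
    convexity and the descents either exclude this or make the third entry move
    into one of these boxes. *)
Lemma dual_slid h t t' : dual t t' -> skew_word (h :: t) ->
    skew_word (h :: t') ->
  dual (slid h t) (slid h t') /\ hole_end h t = hole_end h t'.
Proof.
move=> D w w'; suff [S e] : swap3 (slid h t) (slid h t') /\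
  hole_end h t = hole_end h t'.
  by split=> //; split=> //; rewrite !descents_slid //; case: D.
case: D w w' => -[] z y x [d []] [d1 d2] [d3 d4] w w'.
  have zy : nwcover z y = false :=
    nle_ncover (@skew_word_nle z y [:: x] [:: h] w).
  have yz : nwcover y z = false :=
    nle_ncover (@skew_word_nle y z [:: x] [:: h] w').
  have := top_swap_inner w; rewrite /=.
  case cz: (nwcover z h); case cy: (nwcover y h) => g;
    rewrite /= ?zy ?yz ?cz ?cy /=.
  - have /andP[-> ->] := g d isT isT d1 d2 d3 d4.
    by split=> //; apply: SwapBottom.
  - by case: ifP => _; split=> //; apply: SwapTop.
  - by case: ifP => _; split=> //; apply: SwapTop.
  - by case: ifP => _; split=> //; apply: SwapTop.
have yx : nwcover y x = false := nle_ncover (@skew_word_nle y x [::] [:: h;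
  z] w).
have xy : nwcover x y = false := nle_ncover (@skew_word_nle x y [::] [:: h;
  z] w').
rewrite /=; case cz: (nwcover z h) => /=.
  case cy: (nwcover y z); case cx: (nwcover x z); rewrite /= ?yx ?xy ?cx ?cy.
  - by case: (bottom_swap_square w cz cy cx).
  - by split=> //; apply: SwapBottom.
  - by split=> //; apply: SwapBottom.
  - by split=> //; apply: SwapBottom.
case cy: (nwcover y h); case cx: (nwcover x h); rewrite /= ?yx ?xy ?cx ?cy.
- by case: (bottom_swap_row w cx cy d1 d2 d3).
- by split=> //; apply: SwapBottom.
- by split=> //; apply: SwapBottom.
- by split=> //; apply: SwapBottom.
Qed.

(** Three successive slides through [v]; the last letter of [t] starts first. *)
Definition slid3 (t v : seq box) : seq box :=
  if t is [:: c; b; a] then slid c (slid b (slid a v)) else v.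

(** The same exchanges followed from the side of the entry: a letter [e] passes
    the holes [t] from right to left.  The result consists of the new holes and of
    the letter that comes out. *)
Fixpoint pass_left (t : seq box) (e : box) : seq box * box :=
  if t is c :: t' then
    let: (t1, f) := pass_left t' e in if nwcover f c then (f :: t1,
      c) else (c :: t1, f)
  else ([::], e).

Lemma slid3_cons t e v : size t = 3 ->
    slid3 t (e :: v) = (pass_left t e).2 :: slid3 (pass_left t e).1 v.
Proof.
case: t => [|c [|b [|a []]]] //= _.
by case: ifP => _ /=; case: ifP => _ /=; case: ifP => _ /=.
Qed.

Lemma skew_word_pass_left u t e v : skew_word (u ++ t ++ e :: v) ->
    skew_word (u ++ (pass_left t e).2 :: (pass_left t e).1 ++ v).
Proof.
elim: t u => [|c t IH] u //= w.
have {}w : skew_word (rcons u c ++ t ++ e :: v) by rewrite cat_rcons.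
have {IH}w := IH _ w; case: (pass_left t e) w => t1 f /=;
  rewrite cat_rcons => w.
by case: ifPn => //= nc; apply: skew_word_swap.
Qed.

(** Exchanging adjacent letters is an involution, so a slide undoes a passage to
    the left.  What slides preserve is therefore preserved by [pass_left]. *)
Lemma pass_leftK t e : skew_word (t ++ [:: e]) ->
  slid (pass_left t e).2 (pass_left t e).1 = t /\
    hole_end (pass_left t e).2 (pass_left t e).1 = e.
Proof.
elim: t => [|c t IH] //= w; have [] := IH (skew_word_behead w).
have := @skew_word_pass_left [:: c] t e [::] w;
  case: (pass_left t e) => t1 f /= w1 e1 e2.
case: ifP => /= cf; first by rewrite cf /= e1 e2.
by rewrite (nle_ncover (@skew_word_nle c f (t1 ++ [::]) [::] w1)) /= e1 e2.
Qed.

Lemma descents_pass_left t e : skew_word (t ++ [:: e]) ->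
    descents (pass_left t e).1 = descents t.
Proof.
move=> w; have := @skew_word_pass_left [::] t e [::] w; rewrite /= cats0 => w1.
by rewrite -[in RHS](proj1 (pass_leftK w)) descents_slid.
Qed.

(** [b] and [c] are the south and east neighbours of [e]; the descents would put
    [a] in the row of [e], at or beyond the east one. *)
Lemma top_swap_row (c b a e : box) d : skew_word [:: c; b; a;
    e] -> nwcover e c -> nwcover e b ->
  (b.1 < c.1) = d -> (a.1 < b.1) = ~~ d -> (a.1 < c.1) = d -> False.
Proof.
case=> + _; rewrite /linext /= !andbT.
case: c b a e => [c1 c2] [b1 b2] [a1 a2] [e1 e2] + /nwcover_cases f1
  /nwcover_cases f2.
move: f1 f2; rewrite /nwle /= => -[[g1 g2]|[g1 g2]] [[g3 g4]|[g3 g4]]; subst;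
  case: d => //=.
all: lia.
Qed.

(** Whichever side of [a] the letter [e] is on, [e] and one of [b], [c] would be
    opposite corners of a 2 by 2 square with a missing box. *)
Lemma top_swap_square (c b a e : box) : skew_word [:: c; b; a;
    e] -> nwcover a b -> nwcover a c -> nwcover e a -> False.
Proof.
move=> w.
have cW : c \in [:: c; b; a; e] by rewrite !inE eqxx.
have bW : b \in [:: c; b; a; e] by rewrite !inE eqxx !orbT.
have eW : e \in [:: c; b; a; e] by rewrite !inE eqxx !orbT.
have := w => -[]; rewrite /linext /= !andbT => /and3P[/and3P[l1 _ _] _ _] _.
have := skew_word_north w eW cW; have := skew_word_north w eW bW.
have := skew_word_west w eW cW; have := skew_word_west w eW bW.
rewrite !inE /eq_op /=.
case: c b a e l1 {w cW bW eW} =>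
  [c1 c2] [b1 b2] [a1 a2] [e1 e2] + + + + + /nwcover_cases f1 /nwcover_cases f2
  /nwcover_cases f3.
move: f1 f2 f3; rewrite /nwle /= =>
  -[[g1 g2]|[g1 g2]] [[g3 g4]|[g3 g4]] [[g5 g6]|[g5 g6]]; subst;
   rewrite ?leqnn ?ltnn ?andbF //=.
all: lia.
Qed.

(** [a] and [b] are the south and east neighbours of [e].  The descents put [c]
    in the row of the lower one, and by convexity it is then the box that
    completes the 2 by 2 square. *)
Lemma bottom_swap_outer (c b a e : box) d : skew_word [:: c; b; a;
    e] -> nwcover e a -> nwcover e b ->
  (b.1 < c.1) = d -> (a.1 < b.1) = ~~ d -> (a.1 < c.1) = ~~ d ->
    (b.1 < a.1) = d ->
  nwcover a c && nwcover b c.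
Proof.
move=> w.
have cW : c \in [:: c; b; a; e] by rewrite !inE eqxx.
have bW : b \in [:: c; b; a; e] by rewrite !inE eqxx !orbT.
have aW : a \in [:: c; b; a; e] by rewrite !inE eqxx !orbT.
have := w => -[]; rewrite /linext /= !andbT => /and3P[/and3P[l1 l2 _] _ _] _.
have := skew_word_west w aW cW; have := skew_word_west w bW cW.
rewrite !inE /eq_op /=.
case: c b a e l1 l2 {w cW bW aW} =>
  [c1 c2] [b1 b2] [a1 a2] [e1 e2] + + + + /nwcover_cases f1 /nwcover_cases f2.
move: f1 f2; rewrite /nwcover /nwle /= =>
  -[[g1 g2]|[g1 g2]] [[g3 g4]|[g3 g4]]; subst;
   rewrite ?leqnn ?ltnn ?andbF //=; case: d => //=.
all: lia.
Qed.

(** The mirror image of [dual_slid]: dually equivalent triples of holes let a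
    letter out at the same box and stay dually equivalent. *)
Lemma dual_pass_left t t' e : dual t t' -> skew_word (t ++ [:: e]) ->
    skew_word (t' ++ [:: e]) ->
  dual (pass_left t e).1 (pass_left t' e).1 /\
    (pass_left t e).2 = (pass_left t' e).2.
Proof.
move=> D w w'; suff [S f] : swap3 (pass_left t e).1 (pass_left t' e).1 /\
  (pass_left t e).2 = (pass_left t' e).2.
  by split=> //; split=> //; rewrite !descents_pass_left //; case: D.
case: D w w' => -[] c b a [d []] [d1 d2] [d3 d4] /= w w'.
  have cb : nwcover c b = false := nle_ncover (@skew_word_nle c b [:: a;
    e] [::] w).
  have bc : nwcover b c = false := nle_ncover (@skew_word_nle b c [:: a;
    e] [::] w').
  case ea: (nwcover e a) => /=.
    case ab: (nwcover a b); case ac: (nwcover a c); rewrite /= ?ab ?ac ?cb ?bc.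
    - by case: (top_swap_square w ab ac ea).
    - by split=> //; apply: SwapTop.
    - by split=> //; apply: SwapTop.
    - by split=> //; apply: SwapTop.
  case eb: (nwcover e b); case ec: (nwcover e c); rewrite /= ?eb ?ec ?cb ?bc.
  - by case: (top_swap_row w ec eb d1 d2 d4).
  - by split=> //; apply: SwapTop.
  - by split=> //; apply: SwapTop.
  - by split=> //; apply: SwapTop.
have ba : nwcover b a = false :=
  nle_ncover (@skew_word_nle b a [:: e] [:: c] w).
have ab : nwcover a b = false :=
  nle_ncover (@skew_word_nle a b [:: e] [:: c] w').
case ea: (nwcover e a); case eb: (nwcover e b); rewrite /= ?ea ?eb ?ab ?ba.
- have /andP[-> ->] := bottom_swap_outer w ea eb d1 d2 d3 d4.
  by split=> //; apply: SwapTop.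
- by case: ifP => _; split=> //; apply: SwapBottom.
- by case: ifP => _; split=> //; apply: SwapBottom.
- by case: ifP => _; split=> //; apply: SwapBottom.
Qed.

Lemma dual_size t t' : dual t t' -> size t = 3 /\ size t' = 3.
Proof. by case=> -[]. Qed.

Lemma dual_slid3 t t' v : dual t t' -> skew_word (t ++ v) ->
    skew_word (t' ++ v) -> slid3 t v = slid3 t' v.
Proof.
elim: v t t' => [|e v IH] t t' D w w'; first by case: D => -[].
have [s s'] := dual_size D; rewrite !slid3_cons //.
have w1 : skew_word (t ++ [:: e]) by rewrite -cat_rcons -cats1 in w;
  case/skew_word_cat: w.
have w1' : skew_word (t' ++ [:: e]) by rewrite -cat_rcons -cats1 in w';
  case/skew_word_cat: w'.
have [D1 <-] := dual_pass_left D w1 w1'; congr cons; apply: IH => //.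
  exact: skew_word_behead (@skew_word_pass_left [::] t e v w).
exact: skew_word_behead (@skew_word_pass_left [::] t' e v w').
Qed.

(** * Words of rows and the relations of the symmetric group *)

Definition in_stair (k : nat) (b : box) : bool :=
  [&& 0 < b.1, 0 < b.2 & b.1 + b.2 <= k.+1].

(** What is left of a staircase tableau after some truncated slides: boxes have
    been vacated at the inner boundary, the outer boundary is still that of the
    staircase. *)
Definition stair_word (k : nat) (W : seq box) : Prop :=
  [/\ linext W, (forall x : box, x \in W -> in_stair k x)
    & forall x y : box, x \in W -> in_stair k y -> nwle x y -> y \in W].

Lemma stair_word_skew k W : stair_word k W -> skew_word W.
Proof.
case=> l sc cl; split=> // x y z xW yW xz zy; apply: (cl x) => //.
have := sc _ xW; have := sc _ yW; move: xz zy; rewrite /nwle /in_stair; lia.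
Qed.

Lemma stair_word_perm k W W' : perm_eq W W' -> linext W' ->
    stair_word k W -> stair_word k W'.
Proof.
move=> p l [_ sc cl]; split=> // [x|x y]; rewrite -!(perm_mem p);
  first exact: sc.
exact: cl.
Qed.

Lemma stair_word_slide k h s : stair_word k (h :: s) ->
    stair_word k (slid h s ++ [:: hole_end h s]).
Proof.
move=> w; apply: stair_word_perm (w); first by rewrite perm_sym perm_slide.
by case: (skew_word_slide (stair_word_skew w)).
Qed.

Lemma stair_word_belast k s g : stair_word k (s ++ [:: g]) -> stair_word k s.
Proof.
case=> l sc cl; split=> [|x xs|x y xs ky xy].
- by move: l; rewrite linext_cat => /and3P[].
- by apply: sc; rewrite mem_cat xs.
have: y \in s ++ [:: g] by apply: (cl x) => //; rewrite mem_cat xs.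
rewrite mem_cat => /orP[//|]; rewrite inE => /eqP yg.
move: l; rewrite linext_cat => /and3P[/allrelP/(_ x g xs)].
by rewrite inE eqxx -yg xy => /(_ isT).
Qed.

Lemma stair_word_slid k h s : stair_word k (h :: s) -> stair_word k (slid h s).
Proof. by move/stair_word_slide/stair_word_belast. Qed.

Lemma in_stair_succ k (b : box) : in_stair k b -> b.1 + b.2 != k.+1 ->
  in_stair k (b.1.+1, b.2) /\ in_stair k (b.1, b.2.+1).
Proof. rewrite /in_stair /=; lia. Qed.

Lemma head_corner k h s : stair_word k (h :: s) -> h.1 + h.2 = k.+1.
Proof.
case=> l sc cl; apply/eqP; apply: contraT => n.
have hW : h \in h :: s by rewrite inE eqxx.
have [i1 i2] := in_stair_succ (sc _ hW) n.
have lh : nwle h (h.1.+1, h.2) by rewrite /nwle /=; lia.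
have := cl h _ hW i1 lh; rewrite inE => /orP[/eqP/(congr1 fst)/=|xs];
  first by lia.
by move: l; rewrite linext_cons => /andP[/allP/(_ _ xs)]; rewrite lh.
Qed.

(** A box that is not a corner has a south and an east neighbour in the
    staircase, and both carry larger entries; here only one entry is larger. *)
Lemma second_corner k z y s : stair_word k (z :: y :: s) -> y.1 + y.2 = k.+1.
Proof.
case=> l sc cl; apply/eqP; apply: contraT => n.
have yW : y \in z :: y :: s by rewrite !inE eqxx orbT.
have [i1 i2] := in_stair_succ (sc _ yW) n.
have l1 : nwle y (y.1.+1, y.2) by rewrite /nwle /=; lia.
have l2 : nwle y (y.1, y.2.+1) by rewrite /nwle /=; lia.
have := cl y _ yW i1 l1; have := cl y _ yW i2 l2.
move: l; rewrite !linext_cons => /and3P[_ /allP a _].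
rewrite !inE => /or3P[/eqP e1|/eqP/(congr1 snd)/=|/a]; [|by lia|by rewrite l2].
move=> /or3P[/eqP e2|/eqP/(congr1 fst)/=|/a]; [|by lia|by rewrite l1].
by move: (congr1 fst (etrans e1 (esym e2))) => /=; lia.
Qed.

(** By the same count, the south and east neighbours of an inner box [x] are the
    boxes of the two larger entries. *)
Lemma third_corner_or_inner k z y x s : stair_word k (z :: y :: x :: s) ->
  x.1 + x.2 = k.+1 \/ nwcover x z /\ nwcover x y.
Proof.
case=> l sc cl; case: (x.1 + x.2 =P k.+1) => [|/eqP n]; [by left | right].
have xW : x \in [:: z, y, x & s] by rewrite !inE eqxx !orbT.
have [i1 i2] := in_stair_succ (sc _ xW) n.
have l1 : nwle x (x.1.+1, x.2) by rewrite /nwle /=; lia.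
have l2 : nwle x (x.1, x.2.+1) by rewrite /nwle /=; lia.
have := cl x _ xW i1 l1; have := cl x _ xW i2 l2.
move: l; rewrite !linext_cons => /and4P[_ _ /allP a _].
have ne1 : (x.1.+1, x.2) == x = false by apply/eqP => /(congr1 fst)/=; lia.
have ne2 : (x.1, x.2.+1) == x = false by apply/eqP => /(congr1 snd)/=; lia.
rewrite !inE ne1 ne2 /=.
case/or3P => [/eqP e1|/eqP e1|/a]; [| |by rewrite l2];
case/or3P => [/eqP e2|/eqP e2|/a]; try by rewrite l1.
- by move: (congr1 fst (etrans e1 (esym e2))) => /=; lia.
- by rewrite /nwcover -e1 -e2 /= !eqxx /= !orbT.
- by rewrite /nwcover -e1 -e2 /= !eqxx /= !orbT.
- by move: (congr1 fst (etrans e1 (esym e2))) => /=; lia.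
Qed.

Lemma nwcover_sum x y : nwcover x y -> (x.1 + x.2).+1 = y.1 + y.2.
Proof. rewrite /nwcover; lia. Qed.

Lemma corner_ncover k (x y : box) : x.1 + x.2 = k -> y.1 + y.2 = k ->
    nwcover x y = false.
Proof. by move=> a b; apply/negP => /nwcover_sum; lia. Qed.

(** The rows of the successive largest entries.  On a staircase these entries
    sit in corners, and the rows are read as a word in the generators of the
    symmetric group. *)
Fixpoint corner_rows_rec n (W : seq box) : seq nat :=
  if n is m.+1 then if W is h :: s then h.1 :: corner_rows_rec m (slid h s)
    else [::]
  else [::].
Definition corner_rows W := corner_rows_rec (size W) W.

Lemma corner_rows_cons h s : corner_rows (h :: s) =
    h.1 :: corner_rows (slid h s).
Proof. by rewrite /corner_rows /= size_slid. Qed.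

Definition adj_transp (i m : nat) : nat :=
  if m == i then i.+1 else if m == i.+1 then i else m.

Definition act_word (l : seq nat) (m : nat) : nat :=
  foldl (fun m i => adj_transp i m) m l.

Lemma adj_transp_comm i j m : i.+1 < j \/ j.+1 < i ->
  adj_transp i (adj_transp j m) = adj_transp j (adj_transp i m).
Proof. by rewrite /adj_transp; do !case: eqP => //=; lia. Qed.

Lemma adj_transp_braid i j m : i.+1 = j \/ j.+1 = i ->
  adj_transp i (adj_transp j (adj_transp i m)) =
    adj_transp j (adj_transp i (adj_transp j m)).
Proof. by rewrite /adj_transp; case=> <-; do !case: eqP => //=; lia. Qed.

Lemma adj_transpK i : involutive (adj_transp i).
Proof. by move=> m; rewrite /adj_transp; do !case: eqP => //=; lia. Qed.

Lemma act_word_inj l : injective (act_word l).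
Proof.
elim: l => [|i l IH] a b //= /IH; exact: (can_inj (adj_transpK i)).
Qed.

(** The three largest entries sit in corners and do not move before their turn;
    the three holes then meet the rest of the word in the opposite order, as the
    first one is the furthest ahead. *)
Lemma corner_rows_three k z y x v : stair_word k [:: z, y, x & v] ->
    x.1 + x.2 = k.+1 ->
  corner_rows ([:: z; y; x] ++ v) = [:: z.1, y.1,
    x.1 & corner_rows (slid3 [:: x; y; z] v)] /\
  skew_word [:: x, y, z & v].
Proof.
move=> w cx; have cz := head_corner w; have cy := second_corner w.
have c := @corner_ncover k.+1.
split.
  by rewrite corner_rows_cons /= (c y z) // (c x z) // corner_rows_cons /= (c x
    y) // corner_rows_cons.
have yz : ~~ nwcover y z by rewrite c.
have xz : ~~ nwcover x z by rewrite c.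
have xy : ~~ nwcover x y by rewrite c.
have w1 := @skew_word_swap [::] _ _ _ yz (stair_word_skew w).
have w2 := @skew_word_swap [:: y] _ _ _ xz w1.
exact: (@skew_word_swap [::] _ _ _ xy w2).
Qed.

(** The first slide moves the entry of [x] into the corner [z], from where the
    third slide starts. *)
Lemma corner_rows_braid k z y x v : stair_word k [:: z, y, x & v] ->
    nwcover x z -> nwcover x y ->
  corner_rows ([:: z; y; x] ++ v) = [:: z.1, y.1,
    z.1 & corner_rows (slid3 [:: z; y; x] v)].
Proof.
move=> w cx cx'; have cz := head_corner w; have cy := second_corner w.
have yz := corner_ncover cy cz; have zy := corner_ncover cz cy.
by rewrite !corner_rows_cons /= yz cx corner_rows_cons /= zy corner_rows_cons.
Qed.

Lemma corner_row k (x y : box) : x.1 + x.2 = k -> y.1 + y.2 = k ->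
    ~~ nwle x y -> x.1 <> y.1.
Proof. rewrite /nwle; lia. Qed.

Lemma linext_three z y x v : linext ([:: z; y; x] ++ v) ->
  [/\ ~~ nwle z y, ~~ nwle z x & ~~ nwle y x].
Proof. by rewrite /linext /= => /and3P[/and3P[-> -> _] /andP[-> _] _]. Qed.

(** When the third entry is in a corner, its descents put it between the
    exchanged corners, whose generators therefore commute.  When it is in an inner
    box, that box is adjacent to both corners and the words of rows are the two
    sides of a braid relation. *)
Lemma dual_act_head k t t' v m : dual t t' -> stair_word k (t ++ v) ->
    stair_word k (t' ++ v) ->
  act_word (corner_rows (t ++ v)) m = act_word (corner_rows (t' ++ v)) m.
Proof.
case=> -[] z y x [d [[d1 d2] [d3 d4]]] w w'.
  have cz := head_corner w; have cy := second_corner w.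
  have [nzy nzx nyx] := linext_three (proj1 (stair_word_skew w)).
  have rzy := corner_row cz cy nzy.
  case: (third_corner_or_inner w) => [cx|[c1 c2]].
    have rzx := corner_row cz cx nzx; have ryx := corner_row cy cx nyx.
    have [e w1] := corner_rows_three w cx;
      have [e' w1'] := corner_rows_three w' cx.
    rewrite e e' (@dual_slid3 [:: x; y; z] [:: x; z; y] v _ w1 w1').
      by rewrite /= (@adj_transp_comm z.1) //; case: d d1 d2 d3 d4 => /=; lia.
    split; first exact: SwapBottom.
    by exists d; split=> /=; congr [:: _; _]; case: d d1 d2 d3 d4; lia.
  rewrite (corner_rows_braid w c1 c2) (corner_rows_braid w' c2 c1).
  rewrite (@dual_slid3 [:: z; y; x] [:: y; z;
    x] v _ (stair_word_skew w) (stair_word_skew w')).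
    rewrite /= adj_transp_braid //; move: c1 c2 cz cy nzy;
      rewrite /nwcover /nwle; clear; lia.
  split; first exact: SwapTop.
  by exists d; rewrite /= d1 d2 d3 d4.
have cz := head_corner w; have cy := second_corner w;
  have cx := second_corner w'.
have [nzy nzx nyx] := linext_three (proj1 (stair_word_skew w)).
have rzy := corner_row cz cy nzy.
have rzx := corner_row cz cx nzx; have ryx := corner_row cy cx nyx.
have [e w1] := corner_rows_three w cx; have [e' w1'] := corner_rows_three w' cy.
rewrite e e' (@dual_slid3 [:: x; y; z] [:: y; x; z] v _ w1 w1').
  by rewrite /= (@adj_transp_comm x.1 y.1) //; case: d d1 d2 d3 d4 => /=; lia.
split; first exact: SwapTop.
by exists d; split=> /=; congr [:: _; _]; case: d d1 d2 d3 d4; lia.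
Qed.

(** The slides that start in the prefix [u] carry the equivalence along until its
    three letters stand at the head of the word. *)
Lemma dual_act_word k u t t' v m : dual t t' ->
    stair_word k (u ++ t ++ v) -> stair_word k (u ++ t' ++ v) ->
  act_word (corner_rows (u ++ t ++ v)) m =
    act_word (corner_rows (u ++ t' ++ v)) m.
Proof.
move: {2}(size u) (erefl (size u)) => n;
  elim: n u t t' v m => [|n IH] u t t' v m.
  by move/size0nil=> ->; apply: dual_act_head.
case: u => [//|h u] [su] D w w'.
have w1 : skew_word (slid h u ++ hole_end h u :: t ++ v) :=
  @skew_word_slide_cat [::] _ _ _ (stair_word_skew w).
have w1' : skew_word (slid h u ++ hole_end h u :: t' ++ v) :=
  @skew_word_slide_cat [::] _ _ _ (stair_word_skew w').
have [D1 e] := dual_slid D (proj1 (@skew_word_cat (hole_end h u :: t) v (proj2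
  (skew_word_cat w1))))
  (proj1 (@skew_word_cat (hole_end h u :: t') v (proj2 (skew_word_cat w1')))).
rewrite !cat_cons !corner_rows_cons /= !slid_cat -e; apply: IH => //;
  first by rewrite size_slid.
  by move: (stair_word_slid w); rewrite !slid_cat.
by move: (stair_word_slid w'); rewrite !slid_cat e.
Qed.

(** * Connectedness under dual equivalence *)

(** The straight shapes, that is, the diagrams of partitions. *)
Definition ideal (s : seq box) : Prop :=
  forall x y : box, x \in s -> 0 < y.1 -> 0 < y.2 -> nwle y x -> y \in s.

Lemma ideal_tail h s : linext (h :: s) -> ideal (h :: s) -> ideal s.
Proof.
rewrite linext_cons => /andP[/allP a _] i x y xs y1 y2 yx.
have: y \in h :: s by apply: (i x) => //; rewrite inE xs orbT.
by rewrite inE => /orP[/eqP e|//]; move: (a x xs); rewrite -e yx.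
Qed.

Lemma linext_uniq s : linext s -> uniq s.
Proof.
elim: s => [//|x s IH] /andP[/allP a /IH /= ->].
by rewrite andbT; apply/negP => /a; rewrite nwle_refl.
Qed.

Lemma linext_sub s t : subseq s t -> linext t -> linext s.
Proof. exact: subseq_pairwise. Qed.

(** For [x] take the last box in the row above the lower corner [h']: no box
    other than [h] and [h'] lies south-east of it. *)
Lemma maximal_between k h h' s s' : linext (h :: s) ->
    (forall b : box, b \in h :: s -> in_stair k b) -> linext (h' :: s') ->
    perm_eq (h :: s) (h' :: s') -> ideal (h :: s) -> h.1 < h'.1 ->
  exists x v, [/\ h.1 <= x.1 < h'.1, perm_eq s [:: h', x & v]
                & linext [:: h, h', x & v]].
Proof.
move=> l sc l' p i lt.
have /andP[/allP ah ls] : all (fun x : box => ~~ nwle h x) s && linext s by [].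
have /andP[/allP ah' _] : all (fun x : box =>
  ~~ nwle h' x) s' && linext s' by [].
have us := linext_uniq ls.
have h's : h' \in s.
  have: h' \in h :: s by rewrite (perm_mem p) inE eqxx.
  by rewrite inE => /orP[/eqP e|//]; move: lt; rewrite e ltnn.
set s2 := rem h' s.
have p2 : perm_eq s (h' :: s2) by exact: perm_to_rem.
have max' (y : box) : y \in s2 -> ~~ nwle h' y.
  move=> ys2; apply: ah'.
  have: y \in h :: s by rewrite inE (perm_mem p2) inE ys2 !orbT.
  rewrite (perm_mem p) inE => /orP[/eqP e|//].
  by move: ys2; rewrite e /s2 mem_rem_uniq // inE eqxx.
have h1 : 0 < h.1 by have /and3P[] := sc h (mem_head _ _).
have h'2 : 0 < h'.2 by have /and3P[] := sc h' (mem_behead (s := h :: s) h's).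
(* the row above h' is not exhausted, and c bounds the column of x *)
pose c : box := (h'.1.-1, h'.2).
have cs2 : c \in s2.
  have: c \in h :: s.
    by apply: (i h'); rewrite ?inE ?h's ?orbT // /nwle /=; lia.
  rewrite inE => /orP[/eqP e|].
    by move: (ah _ h's); rewrite -e /nwle /=; lia.
  rewrite (perm_mem p2) inE => /orP[/eqP/(congr1 fst)/=|//]; lia.
(* letters of one row come by decreasing column: the first is the last box *)
pose F := [seq b : box <- s2 | b.1 == h'.1.-1].
have lF : linext F.
  apply: linext_sub ls; exact: subseq_trans (filter_subseq _ _) (rem_subseq _
    _).
have: c \in F by rewrite mem_filter eqxx.
case eF : F lF => [//|x F']; rewrite linext_cons => /andP[/allP xF' _] cF.
have: x \in F by rewrite eF mem_head.
rewrite mem_filter => /andP[/eqP x1 xs2].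
exists x, (rem x s2).
have p3 : perm_eq s2 (x :: rem x s2) by exact: perm_to_rem.
have p4 : perm_eq s [:: h', x & rem x s2].
  by apply: perm_trans p2 _; rewrite perm_cons.
split=> //; first lia.
rewrite !linext_cons; apply/and4P; split.
- by apply/allP => y; rewrite -(perm_mem p4); apply: ah.
- by apply/allP => y; rewrite -(perm_mem p3); apply: max'.
- have us2 : uniq s2 by rewrite rem_uniq.
  apply/allP => y; rewrite mem_rem_uniq // inE => /andP[yx ys2];
    apply/negP => xy.
  have [e|ne] := eqVneq (y : box).1 h'.1.-1.
    have: y \in F by rewrite mem_filter e eqxx.
    by rewrite eF inE (negbTE yx) /= => /xF'; rewrite xy.
  have : h'.2 <= x.2.
    move: cF; rewrite inE => /orP[/eqP <-//|/xF'].
    by rewrite /nwle x1 leqnn -ltnNge => /ltnW.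
  by move: (max' y ys2) xy ne lt; rewrite /nwle x1; clear; lia.
apply: linext_sub ls; exact: subseq_trans (rem_subseq _ _) (rem_subseq _ _).
Qed.

Lemma stair_word_cat_perm k u s t : stair_word k (u ++ s) -> perm_eq s t ->
    linext t -> stair_word k (u ++ t).
Proof.
move=> w p l; apply: stair_word_perm (w); first by rewrite perm_cat2l.
case: w => + _ _; rewrite !linext_cat l => /and3P[/allrelP a -> _] /=.
by rewrite andbT; apply/allrelP => x y xu yt; apply: a; rewrite // (perm_mem p).
Qed.

(** Two tableaux of a straight shape are connected by elementary dual
    equivalences.  If their largest entries share a box this is the induction
    hypothesis, for a longer prefix [u].  If they sit in different corners [h] and
    [h'], one passes through two tableaux with top entries in [h], [h'] and in a
    box between them; these are related by a single exchange. *)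
Lemma act_word_const k u s s' m : stair_word k (u ++ s) ->
    stair_word k (u ++ s') ->
  perm_eq s s' -> ideal s -> act_word (corner_rows (u ++ s)) m =
    act_word (corner_rows (u ++ s')) m.
Proof.
move: {2}(size s) (erefl (size s)) => n; elim: n u s s' m => [|n IH] u s s' m.
  by move=> /size0nil -> _ _ /perm_size/esym/size0nil ->.
have key h h' s1 s1' : size s1 = n -> size s1' = n ->
  stair_word k (u ++ h :: s1) -> stair_word k (u ++ h' :: s1') ->
  perm_eq (h :: s1) (h' :: s1') -> ideal (h :: s1) -> h.1 < h'.1 ->
  act_word (corner_rows (u ++ h :: s1)) m =
    act_word (corner_rows (u ++ h' :: s1')) m.
  move=> z z' w w' p i lt.
  have lh : linext (h :: s1) by case: w; rewrite linext_cat => /and3P[].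
  have lh' : linext (h' :: s1') by case: w'; rewrite linext_cat => /and3P[].
  have sc (b : box) : b \in h :: s1 -> in_stair k b.
    by case: w => _ + _ b1; apply; rewrite mem_cat b1 orbT.
  have [x [v [xr p1 lA]]] := maximal_between lh sc lh' p i lt.
  have pA : perm_eq (h :: s1) [:: h, h', x & v] by rewrite perm_cons.
  have pAB : perm_eq [:: h, h', x & v] [:: h', h, x & v].
    by rewrite -(cat1s h) -(cat1s h') perm_catCA.
  have pB : perm_eq (h' :: s1') [:: h', h, x & v].
    by rewrite perm_sym in p; apply: perm_trans p (perm_trans pA pAB).
  have wA := stair_word_cat_perm w pA lA.
  have lB : linext [:: h', h, x & v].
    have h1' : h \in s1'.
      have: h \in h' :: s1' by rewrite -(perm_mem p) mem_head.
      by rewrite inE => /orP[/eqP e|//]; move: lt; rewrite e ltnn.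
    have {lh'}/andP[/allP/(_ _ h1') nh' _] := lh'.
    have /andP[/andP[_ a1] /andP[a2 a3]] := lA.
    by apply/andP; split; apply/andP.
  have wB := stair_word_cat_perm w' pB lB.
  have D : dual [:: h; h'; x] [:: h'; h; x].
    split; first exact: SwapTop.
    by exists false; split=> /=; congr [:: _; _]; move: xr lt; clear; lia.
  have e1 : act_word (corner_rows (u ++ h :: s1)) m =
    act_word (corner_rows (u ++ [:: h, h', x & v])) m.
    have := IH (rcons u h) s1 [:: h', x & v] m; rewrite !cat_rcons; apply=> //.
    exact: ideal_tail i.
  have e2 : act_word (corner_rows (u ++ h' :: s1')) m =
    act_word (corner_rows (u ++ [:: h', h, x & v])) m.
    have := IH (rcons u h') s1' [:: h, x & v] m; rewrite !cat_rcons; apply=> //.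
      by rewrite -(perm_cons h').
    apply: (ideal_tail lh') => a b; rewrite -!(perm_mem p); exact: i.
  by rewrite e1 e2; apply: (@dual_act_word k u _ _ v m D).
case: s s' => [//|h s1] [|h' s1'] // [z] w w' p i.
  by have := perm_size p.
have [z'] := perm_size p; rewrite z in z'.
have [e|ne] := eqVneq h h'.
  subst h'; have := IH (rcons u h) s1 s1' m; rewrite !cat_rcons; apply=> //.
    by rewrite -(perm_cons h).
  by apply: ideal_tail i; case: w; rewrite linext_cat => /and3P[].
case: (ltngtP h.1 h'.1) => lt; first exact: key.
  symmetry; apply: key => //; first by rewrite perm_sym.
  by move=> a b; rewrite -!(perm_mem p); exact: i.
have lh : linext (h :: s1) by case: w; rewrite linext_cat => /and3P[].
have lh' : linext (h' :: s1') by case: w'; rewrite linext_cat => /and3P[].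
have h's : h' \in s1.
  have: h' \in h :: s1 by rewrite (perm_mem p) mem_head.
  by rewrite inE eq_sym (negbTE ne).
have hs : h \in s1'.
  have: h \in h' :: s1' by rewrite -(perm_mem p) mem_head.
  by rewrite inE (negbTE ne).
move: lh lh'; rewrite !linext_cons =>
  /andP[/allP/(_ _ h's) + _] /andP[/allP/(_ _ hs) + _].
by rewrite /nwle lt; clear; lia.
Qed.

(** * The corner of the largest entry after a full round of promotions *)

(** The final holes, in the order in which evacuation numbers them. *)
Fixpoint evac_word_rec n (W : seq box) : seq box :=
  if n is m.+1 then if W is h :: s then hole_end h s :: evac_word_rec m (slid h
    s) else [::]
  else [::].
Definition evac_word W := evac_word_rec (size W) W.

Lemma evac_word_cons h s : evac_word (h :: s) =
    hole_end h s :: evac_word (slid h s).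
Proof. by rewrite /evac_word /= size_slid. Qed.

Lemma size_evac_word s : size (evac_word s) = size s.
Proof.
move: {2}(size s) (erefl (size s)) => n; elim: n s => [|n IH] [|h s] // [e].
by rewrite evac_word_cons /= IH ?size_slid ?e.
Qed.

Lemma perm_evac_word s : perm_eq (evac_word s) s.
Proof.
move: {2}(size s) (erefl (size s)) => n; elim: n s => [|n IH] [|h s] // [e].
rewrite evac_word_cons -(permPr (perm_slide h s)) cats1 perm_sym perm_rcons.
by rewrite perm_cons perm_sym IH ?size_slid.
Qed.

(** Where the last letter [g] of a word goes when a slide reaches it with the
    hole at [e]. *)
Definition displace (g e : box) : box := if nwcover g e then e else g.

Lemma slid_rcons h s g : slid h (s ++ [:: g]) =
    slid h s ++ [:: displace g (hole_end h s)].
Proof. by rewrite slid_cat /= /displace; case: ifP. Qed.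

(** The appended letter is the last to become the largest; by then the slides
    have carried it to the box given by [displace]. *)
Lemma corner_rows_rcons s g : corner_rows (s ++ [:: g]) =
    corner_rows s ++ [:: (foldl displace g (evac_word s)).1].
Proof.
move: {2}(size s) (erefl (size s)) => n; elim: n s g => [|n IH] [|h s] g // [e].
by rewrite cat_cons !corner_rows_cons slid_rcons IH ?size_slid //
  evac_word_cons.
Qed.

Lemma corner_rows_bound k W i : stair_word k W -> i \in corner_rows W ->
    0 < i <= k.
Proof.
move: {2}(size W) (erefl (size W)) => n; elim: n W => [|n IH] [|h s] // [e] w.
rewrite corner_rows_cons inE => /orP[/eqP ->|]; last by apply: IH;
  rewrite ?size_slid //; exact: stair_word_slid.
by case: (w) => _ /(_ h (mem_head _ _)) /and3P[]; have := head_corner w; lia.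
Qed.

Lemma descents_last (u : seq box) (g o : box) : last false (descents (u ++ [::
    g; o])) = (o.1 < g.1).
Proof.
elim: u => [|x u IH] //; rewrite -IH.
by case: u {IH} => [|y [|z u]].
Qed.

(** Slides preserve descents, so the rows of the last two letters compare like
    those of the corners from which these letters finally start their slides. *)
Lemma first_letter_descent k s g : stair_word k (s ++ [:: g]) -> 0 < size s ->
  ((foldl displace g (evac_word s)).1 < (last g (evac_word s)).1) =
    last false (descents (s ++ [:: g])).
Proof.
move: {2}(size s) (erefl (size s)) => n;
  elim: n s g => [|n IH] [|h s] g // [e] w _.
case: s e w => [|y s] e w.
  by rewrite /= /displace (corner_ncover (second_corner w) (head_corner w)).
rewrite evac_word_cons [foldl _ _ _]/= [last _ _]/=.
have w1 : stair_word k (slid h ((y :: s) ++ [:: g])) := stair_word_slid w.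
have w2 : descents (slid h ((y :: s) ++ [:: g])) = _ :=
  descents_slid (stair_word_skew w).
have -> : last false (descents ((h :: y :: s) ++ [:: g])) =
  last false (descents ((y :: s) ++ [:: g])).
  by case: (s).
rewrite slid_rcons in w1 w2; rewrite -w2 -IH ?size_slid //.
by have := size_evac_word (slid h (y :: s)); rewrite size_slid;
  case: (evac_word _).
Qed.

(** The words of the standard tableaux of shape [staircase k]. *)
Definition full_word (k : nat) (W : seq box) : Prop :=
  stair_word k W /\ forall b, in_stair k b -> b \in W.

Definition promote (W : seq box) : seq box :=
  if W is h :: s then slid h s ++ [:: hole_end h s] else [::].

Lemma full_word_promote k W : full_word k W -> full_word k (promote W).
Proof.
case: W => // h s [w f]; split; first exact: stair_word_slide.
by move=> b /f; rewrite (perm_mem (perm_slide h s)).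
Qed.

Lemma full_word_perm k W W' : full_word k W -> full_word k W' -> perm_eq W W'.
Proof.
move=> [w f] [w' f']; apply: uniq_perm.
- by case: w => /linext_uniq.
- by case: w' => /linext_uniq.
move=> b; apply/idP/idP => h; [apply: f' | apply: f].
  by case: w => _ + _; apply.
by case: w' => _ + _; apply.
Qed.

Lemma full_word_ideal k W : full_word k W -> ideal W.
Proof.
move=> [[_ sc _] f] x y /sc xs y1 y2 xy; apply: f; move: xs xy y1 y2.
rewrite /in_stair /nwle; lia.
Qed.

Lemma full_word_act k W W' m : full_word k W -> full_word k W' ->
    act_word (corner_rows W) m = act_word (corner_rows W') m.
Proof.
move=> f f'; apply: (@act_word_const k [::]); first exact: (proj1 f).
- exact: (proj1 f').
- exact: full_word_perm f f'.
- exact: full_word_ideal f.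
Qed.

Lemma act_word_cat a b m : act_word (a ++ b) m = act_word b (act_word a m).
Proof. exact: foldl_cat. Qed.

(** The entry 1 created by a promotion is the largest entry once as many
    promotions as there are entries have been done, that one included.  This is
    its box then. *)
Definition first_letter_end (W : seq box) : box :=
  if W is h :: s then foldl displace (hole_end h s) (evac_word (slid h s)) else
    (0, 0).

(** The rows of [W] and of its promotion give the same permutation; the two words
    differ by the first letter of one and the last letter of the other, so this
    permutation conjugates the corresponding generators. *)
Lemma act_word_conj k W0 h s m : full_word k W0 -> full_word k (h :: s) ->
  act_word (corner_rows W0) (adj_transp h.1 m) =
    adj_transp (first_letter_end (h :: s)).1 (act_word (corner_rows W0) m).
Proof.
move=> f0 f.
rewrite (full_word_act _ f0 f) corner_rows_cons /= adj_transpK.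
rewrite (full_word_act _ f0 (full_word_promote f)) /= corner_rows_rcons
  act_word_cat.
by rewrite [act_word [:: _] _]/= adj_transpK.
Qed.

Lemma full_word_head k W0 i : full_word k W0 -> 0 < i <= k ->
  exists s, full_word k ((i, k.+1 - i) :: s).
Proof.
move=> [w f] ik; set c : box := (i, k.+1 - i).
have cs : in_stair k c by rewrite /in_stair /=; lia.
have p := perm_to_rem (f c cs).
exists (rem c W0); split; last by move=> b /f; rewrite (perm_mem p).
apply: stair_word_perm p _ (w); case: w => l sc _; have u := linext_uniq l.
rewrite linext_cons (linext_sub (rem_subseq _ _) l) andbT; apply/allP => x.
rewrite mem_rem_uniq // inE => /andP[/eqP xc /sc /and3P[_ _ ks]].
by apply/negP => cx; apply: xc; apply: box_eqP; move: ks cx; rewrite /nwle /=;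
  lia.
Qed.

Lemma full_word_last k h s : 1 < k -> full_word k (h :: s) ->
    exists s1, s = s1 ++ [:: (1, 1)].
Proof.
move=> k1 [w f]; have : (1, 1) \in h :: s by apply: f; rewrite /in_stair /=;
  lia.
rewrite inE => /orP[/eqP e|]; first by have := head_corner w; rewrite -e /=;
  lia.
move=> o1; case/splitPr: o1 w f => s1 [|x s2] w f; first by exists s1.
case: w => l sc _.
have : in_stair k x by apply: sc; rewrite inE mem_cat !inE eqxx !orbT.
move: l; rewrite linext_cons linext_cat => /and4P[_ _ _ /andP[/= /andP[+ _] _]].
by rewrite /nwle /in_stair /=; lia.
Qed.

(** From the foot of the first column the hole can only move north, so it
    pushes the old entry 1, which becomes 2, out of (1, 1) to the box below. *)
Lemma first_column_descent k s : 1 < k -> full_word k ((k, 1) :: s) ->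
  last false (descents (promote ((k, 1) :: s))).
Proof.
move=> k1 f; have [s1 e] := full_word_last k1 f; subst s.
have [w _] := f.
have pos (b : box) : b \in s1 -> 0 < b.2.
  move=> bs; case: w => _ /(_ b) + _; rewrite inE mem_cat bs orbT => /(_ isT).
  by case/and3P.
have col h : h.2 = 1 -> (hole_end h s1).2 = 1.
  elim: s1 h pos {f w} => [//|x s1 IH] h pos h1 /=.
  have x1 := pos x (mem_head _ _).
  have pos' (b : box) : b \in s1 -> 0 < b.2 by move=> bs; apply: pos;
    rewrite inE bs orbT.
  case: ifP => c; apply: IH => //; move: c x1 h1; rewrite /nwcover; lia.
have := @skew_word_slide_cat [::] _ _ _ (stair_word_skew w).
have {col} := col (k, 1) erefl;
  set g := hole_end _ _ => g1 /= /skew_word_cat[_ wg].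
have fp := full_word_promote f; have [[_ sc _] _] := fp.
have : in_stair k g.
  case: w => _ + _; apply; rewrite -cat_cons mem_cat.
  by rewrite -(perm_mem (perm_slide (k, 1) s1)) mem_cat mem_seq1 eqxx orbT.
move=> kg; have g2 : g.1 = 2.
  by have := skew_word_neighbours wg; move: kg;
    rewrite /= /nwle /in_stair g1 /=; clear; lia.
have c : nwcover (1, 1) g by rewrite /nwcover g1 g2.
by rewrite /= slid_cat hole_end_cat -/g /= c -catA descents_last g2.
Qed.

(** An injective walk with unit steps never turns back, and here it has no room
    to start anywhere but at an end of the interval. *)
Lemma unit_step_injection k (w : nat -> nat) : injective w ->
    (forall i, 0 < i <= k -> exists j, 0 < j <= k /\
       (w i = j /\ w i.+1 = j.+1 \/ w i = j.+1 /\ w i.+1 = j)) ->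
  (forall i, 0 < i <= k -> w i = i /\ w i.+1 = i.+1) \/
  (forall i, 0 < i <= k -> w i + i = k.+2 /\ w i.+1 + i = k.+1).
Proof.
move=> inj H; case: (posnP k) => [->|k0]; first by left=> i; lia.
have [j1 [b1 c1]] := H 1 k0.
have kk : 0 < k <= k by rewrite k0 leqnn.
have [jk [bk ck]] := H k kk.
case: c1 => -[w1 w2].
  have up i : i <= k -> w i.+1 = w 1 + i.
    elim/ltn_ind: i => [[|[|i]]] IH ik; [lia|lia|].
    have e1 := IH i.+1 (ltnSn _) (ltnW ik).
    have e2 := IH i (leqnSn _) (ltnW (ltnW ik)).
    have ne : w i.+3 <> w i.+1 by move/inj; lia.
    have [j [_ c]] := H i.+2 ik; lia.
  left=> -[//|i] ik.
  have e0 := up i (ltnW ik); have e1 := up i.+1 ik; have ek := up k (leqnn k);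
    lia.
have dn i : i <= k -> w i.+1 + i = w 1.
  elim/ltn_ind: i => [[|[|i]]] IH ik; [lia|lia|].
  have e1 := IH i.+1 (ltnSn _) (ltnW ik).
  have e2 := IH i (leqnSn _) (ltnW (ltnW ik)).
  have ne : w i.+3 <> w i.+1 by move/inj; lia.
  have [j [_ c]] := H i.+2 ik; lia.
right=> -[//|i] ik.
have e0 := dn i (ltnW ik); have e1 := dn i.+1 ik; have ek := dn k (leqnn k);
  lia.
Qed.

Lemma act_word_step k W0 h s (w := act_word (corner_rows W0)) (j :=
    (first_letter_end (h :: s)).1) :
    full_word k W0 -> full_word k (h :: s) ->
  0 < j <= k /\ (w h.1 = j /\ w h.1.+1 = j.+1 \/ w h.1 = j.+1 /\ w h.1.+1 = j).
Proof.
move=> f0 f; split.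
  apply: (@corner_rows_bound k (promote (h :: s)));
    first by case: (full_word_promote f).
  by rewrite /= corner_rows_rcons mem_cat mem_seq1 eqxx orbT.
have := act_word_conj h.1 f0 f; rewrite -/w -/j {1}/adj_transp eqxx.
have : w h.1 <> w h.1.+1 by move/act_word_inj; lia.
by rewrite /adj_transp; do !case: eqP => ?; lia.
Qed.

(** The theorem of Edelman and Greene on promotion of staircase tableaux, for the
    largest entry: after as many promotions as there are entries it sits in the
    transposed corner.  The permutation shared by all tableaux permutes the
    simple transpositions by conjugation, so it is the identity or the reversal;
    a tableau whose largest entry is at the foot of the first column excludes the
    identity. *)
Theorem corner_transpose k h s : 1 < k -> full_word k (h :: s) ->
  (first_letter_end (h :: s)).1 + h.1 = k.+1.
Proof.
move=> k1 f; set w := act_word (corner_rows (h :: s)).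
have H i : 0 < i <= k -> exists j, 0 < j <= k /\
       (w i = j /\ w i.+1 = j.+1 \/ w i = j.+1 /\ w i.+1 = j).
  move=> ik; have [s' f'] := full_word_head f ik.
  by have [b c] := act_word_step f f';
    exists (first_letter_end ((i, k.+1 - i) :: s')).1.
have [b c] := act_word_step f f.
have hk : 0 < h.1 <= k.
  have [w0 _] := f; case: (w0) => _ /(_ h (mem_head _ _)) /and3P[];
    have := head_corner w0; lia.
have [E|E] := unit_step_injection (@act_word_inj (corner_rows (h :: s))) H;
  have [e1 e2] := E _ hk; last first.
  by move: c; rewrite -/w; rewrite -/w in e1 e2; lia.
have kk : 0 < k <= k by lia.
have [s' f'] := full_word_head f kk.
have ek : k.+1 - k = 1 by lia.
(* under the identity the corner (k, 1) would be reached again,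
   but l is a box of the staircase in a still lower row *)
rewrite ek in f'; have [b' c'] := act_word_step f f'.
have [/= e3 e4] := E k kk; rewrite -/w in e3 e4.
have fk : (first_letter_end ((k, 1) :: s')).1 = k by move: c' => /=;
  rewrite -/w; lia.
have [fw _] := full_word_promote f'.
have := first_column_descent k1 f'; rewrite -(first_letter_descent fw);
  last first.
  have [s1 ->] := full_word_last k1 f'; by rewrite size_slid size_cat addn1.
set l := last _ _; have : l \in promote ((k, 1) :: s').
  rewrite mem_cat mem_seq1 -(perm_mem (perm_evac_word _)) orbC -in_cons;
    exact: mem_last.
by case: fw => _ sc _ /sc /and3P[]; move: fk => /= ->; lia.
Qed.

(** * Descents of the evacuation *)

(** Followed from the letters of [v], this is the invariance of descents under
    [pass_left]. *)
Lemma descent_two_holes b a v : skew_word [:: b, a & v] ->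
  ((hole_end a v).1 < (hole_end b (slid a v)).1) = (a.1 < b.1).
Proof.
elim: v b a => [//|e v IH] b a w.
have w1 : skew_word [:: b; a; e] by case: (@skew_word_cat [:: b; a; e] v w).
have := congr1 (head false) (@descents_pass_left [:: b; a] e w1);
  have := @skew_word_pass_left [::] [:: b; a] e v w.
have rec b' a' x : skew_word [:: x, b', a' & v] ->
   ((hole_end a' v).1 < (hole_end b' (slid a' v)).1) =
     (a'.1 < b'.1) by move/skew_word_behead/IH.
by move: rec; rewrite /=; case: ifP => c1 /=; case: ifP => c2 /= rec /rec ->.
Qed.

Lemma nth_descents o W j : j.+1 < size W ->
  nth false (descents W) j = ((nth o W j.+1).1 < (nth o W j).1).
Proof. by elim: W j => [|y [|x s] IH] [|j] // l; rewrite -IH. Qed.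

Lemma size_descents W : size (descents W) = (size W).-1.
Proof. by elim: W => [|y [|x s] IH] //=; rewrite IH. Qed.

(** The two largest entries of a staircase tableau are in different corners, and
    the first slide leaves the second corner alone.  So the two slides start in
    these corners, and the order of their rows is kept up to the final holes.
    Evacuation lists the final holes by increasing entries, which turns descents
    into ascents. *)
Lemma evac_word_descents k o W j : stair_word k W -> j.+1 < size W ->
  ((nth o (evac_word W) j).1 < (nth o (evac_word W) j.+1).1) =
    ~~ ((nth o W j.+1).1 < (nth o W j).1).
Proof.
elim: j W => [|j IH] [|z [|y s]] // w l.
  have cz := head_corner w; have cy := second_corner w.
  have yz := corner_ncover cy cz.
  rewrite evac_word_cons /= yz evac_word_cons /= descent_two_holes; last first.
    by apply: (@skew_word_swap [::]); [rewrite yz | exact: stair_word_skew w].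
  have [l1 _ _] := w; have zy : ~~ nwle z y by case/andP: l1 => /andP[].
  by have := corner_row cz cy zy; lia.
rewrite evac_word_cons [nth _ (_ :: _) _]/= [nth _ (_ :: evac_word _) _]/=.
rewrite (IH _ (stair_word_slid w)) ?size_slid // -!nth_descents ?size_slid //
  (descents_slid (stair_word_skew w)) //.
Qed.

Lemma first_letter_corner k s g : stair_word k (s ++ [:: g]) ->
  (foldl displace g (evac_word s)).1 + (foldl displace g (evac_word s)).2 =
    k.+1.
Proof.
move: {2}(size s) (erefl (size s)) => n; elim: n s g => [|n IH] [|h s] g //.
  by move=> _; exact: head_corner.
move=> [e] w; rewrite evac_word_cons /= IH ?size_slid // -slid_rcons;
  exact: (stair_word_slid w).
Qed.

(** * Words of fillings *)

(** [D] still contains the letters that the hole has passed.  The fifth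
    hypothesis says that they are out of its reach, and remain so. *)
Lemma slide_word f (D : seq box) T h s :
    h.1 + h.2 <= f -> linext (h :: s) -> (forall b : box, b \in s -> b \in D) ->
    (forall b : box, b \in D -> (0 < b.1) && (0 < b.2)) ->
    (forall b : box, b \in D -> b \notin s ->
       ~~ nwcover b h /\ (forall y : box, y \in s -> ~~ nwle b y)) ->
    pairwise gtn (map T s) ->
  [/\ (slide f D T h).1 = hole_end h s,
      map (slide f D T h).2 (slid h s) = map T s
    & forall b, b \notin h :: s -> (slide f D T h).2 b = T b].
Proof.
elim: s f T h => [|x s IH] f T h hf l sD pos low dec.
  case: f hf => [|f] hf /=; first by split.
  have nn : (h.1.-1, h.2) \in D = false.
    apply/negP => nD; have := pos _ nD; have [+ _] := low _ nD isT.
    by rewrite /nwcover /=; clear; lia.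
  have nw : (h.1, h.2.-1) \in D = false.
    apply/negP => nD; have := pos _ nD; have [+ _] := low _ nD isT.
    by rewrite /nwcover /=; clear; lia.
  by rewrite nn nw; split.
have xD : x \in D by apply: sD; rewrite mem_head.
have sD' (b : box) : b \in s -> b \in D by move=> bs; apply: sD;
  rewrite inE bs orbT.
have := l; rewrite !linext_cons [all _ (x :: s)]/= =>
  /and3P[/andP[hx hs] xs ls].
have low2 b : b \in D -> b \notin s -> b != x ->
    ~~ nwcover b h /\ (forall y : box, y \in x :: s -> ~~ nwle b y).
  by move=> bD bs bx; apply: low => //; rewrite inE negb_or bx.
have low' b : b \in D -> b \notin s -> forall y : box, y \in s -> ~~ nwle b y.
  move=> bD bs y ys; have [->|bx] := eqVneq b x; first exact: (allP xs).
  by have [_] := low2 b bD bs bx; apply; rewrite inE ys orbT.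
have /andP[/allP xT dec'] : all (gtn (T x)) (map T s) &&
  pairwise gtn (map T s) by [].
have hxs : h \notin x :: s.
  rewrite inE negb_or; apply/andP; split.
    by apply: contraNneq hx => ->; rewrite nwle_refl.
  by apply/negP => /(allP hs); rewrite nwle_refl.
have xns : x \notin s by apply/negP => /(allP xs); rewrite nwle_refl.
case c: (nwcover x h).
  case: f hf => [|f] hf; first by have := nwcover_sum c; lia.
  have nbr b : b \in D -> nwcover b h -> b != x -> T b < T x.
    move=> bD bh bx; apply: xT; apply: map_f; apply: contraT => bs.
    by have [] := low2 b bD bs bx; rewrite bh.
  have -> : slide f.+1 D T h = slide f D (update T h (T x)) x.
    rewrite /=; case/orP: (c) => /andP[/eqP e1 /eqP e2].
      have e : (h.1.-1, h.2) = x by apply: box_eqP; rewrite /= -?e1 ?e2.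
      rewrite e xD; case: ifP => // wD.
      rewrite nbr //; first by move: (pos _ wD); rewrite /nwcover /=; clear;
        lia.
      by apply/eqP => /(congr1 fst) /=; move: e1; clear; lia.
    have e : (h.1, h.2.-1) = x by apply: box_eqP; rewrite /= -?e2 ?e1.
    rewrite e xD; case: ifP => // nD.
    rewrite ltnNge ltnW //; apply: nbr => //.
      by move: (pos _ nD); rewrite /nwcover /=; clear; lia.
    by apply/eqP => /(congr1 snd) /=; move: e2; clear; lia.
  have mT : map (update T h (T x)) s = map T s.
    apply/eq_in_map => b bs; rewrite /update; case: eqP => // e.
    by move: hxs; rewrite -e inE bs orbT.
  have [] := IH f (update T h (T x)) x.
  - by have := nwcover_sum c; move: hf; clear; lia.
  - by rewrite linext_cons xs.
  - exact: sD'.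
  - exact: pos.
  - move=> b bD bs; split; last exact: low'.
    have [->|bx] := eqVneq b x; first by apply/negP => /nwcover_sum; lia.
    have [_ /(_ x (mem_head _ _))] := low2 b bD bs bx.
    by apply: contra; apply: nwcover_le.
  - by rewrite mT.
  move=> e1 e2 e3; rewrite [hole_end _ _]/= c [slid _ _]/= c; split=> //.
    by rewrite /= e2 mT e3 // /update eqxx.
  move=> b; rewrite inE negb_or => /andP[bh bxs].
  by rewrite e3 // /update (negbTE bh).
have [] := IH f T h hf _ sD' pos _ dec'.
- by rewrite linext_cons hs.
- move=> b bD bs; split; last exact: low'.
  have [->|bx] := eqVneq b x; first by rewrite c.
  by have [] := low2 b bD bs bx.
move=> e1 e2 e3; rewrite [hole_end _ _]/= c [slid _ _]/= c; split=> //.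
  rewrite /= e2 e3 // inE negb_or xns andbT.
  by move: hxs; rewrite inE negb_or eq_sym => /andP[].
move=> b; rewrite !inE !negb_or => /and3P[bh bx bs].
by apply: e3; rewrite inE negb_or bh.
Qed.

Definition word_of (T : filling) (W : seq box) : Prop :=
  [seq T b | b <- W] = rev (iota 1 (size W)).

Lemma rev_iotaS n : rev (iota 1 n.+1) = n.+1 :: rev (iota 1 n).
Proof. by rewrite -[n.+1]addn1 iotaD rev_cat /= add1n addn1. Qed.

Lemma word_of_cons T h s : word_of T (h :: s) ->
    T h = (size s).+1 /\ word_of T s.
Proof. by rewrite /word_of [size _]/= rev_iotaS /= => -[-> ->]. Qed.

Lemma nth_rev_iota n j : j < n -> nth 0 (rev (iota 1 n)) j = n - j.
Proof. by move=> l; rewrite nth_rev ?size_iota // nth_iota; lia. Qed.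

Lemma word_of_nth T W j : word_of T W -> j < size W ->
    T (nth (0, 0) W j) = size W - j.
Proof. by move=> r l; rewrite -(nth_map _ 0) // r nth_rev_iota. Qed.

Lemma nth_word_of T W : (forall j, j < size W ->
    T (nth (0, 0) W j) = size W - j) -> word_of T W.
Proof.
move=> H; apply: (@eq_from_nth _ 0) => [|j];
  rewrite size_map ?size_rev ?size_iota // => l.
by rewrite (nth_map (0, 0)) // H // nth_rev_iota.
Qed.

Lemma word_of_inj T W (x y : box) : word_of T W -> x \in W -> y \in W ->
    T x = T y -> x = y.
Proof.
move=> r xW yW e; rewrite -(nth_index (0, 0) xW) -(nth_index (0, 0) yW);
  congr nth.
have val (b : box) : b \in W -> T b = size W - index b W.
  by move=> bW; rewrite -{1}(nth_index (0, 0) bW) (word_of_nth r) ?index_mem.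
have sub_inj (a b n : nat) : a < n -> b < n -> n - a = n - b -> a = b by lia.
by apply: (@sub_inj _ _ (size W)); rewrite ?index_mem // -!val.
Qed.

Lemma word_of_decreasing T s : word_of T s -> pairwise gtn (map T s).
Proof.
move=> ->; elim: (size s) => [//|n IH]; rewrite rev_iotaS /= IH andbT.
by apply/allP => i; rewrite mem_rev mem_iota /=; lia.
Qed.

Lemma box_of_word D T W b : perm_eq D W -> word_of T W -> b \in W ->
    box_of D T (T b) = b.
Proof.
move=> p r bW; have bD : b \in D by rewrite (perm_mem p).
set i := index (T b) (map T D).
have iD : i < size D by rewrite -(size_map T) index_mem map_f.
apply: (word_of_inj r) => //; first by rewrite -(perm_mem p) mem_nth.
by rewrite -(nth_map _ 0) // nth_index // map_f.
Qed.

Definition positive_boxes (D : seq box) : Prop := forall b : box, b \in D ->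
  (0 < b.1) && (0 < b.2).

Lemma slide_from_word D T h s : perm_eq D (h :: s) -> positive_boxes D ->
    linext (h :: s) ->
    word_of T (h :: s) ->
  let r := slide_from D T (box_of D T (size (h :: s))) in
  r.1 = hole_end h s /\ word_of r.2 (slid h s).
Proof.
move=> p pos l r; have [Th rs] := word_of_cons r.
rewrite [size _]/= -Th (box_of_word p r (mem_head _ _)) /slide_from.
have [] := @slide_word (h.1 + h.2) D T h s (leqnn _) l.
- by move=> b bs; rewrite (perm_mem p) inE bs orbT.
- exact: pos.
- move=> b; rewrite (perm_mem p) inE => /orP[/eqP->|->//] _; split.
    by apply/negP => /nwcover_sum; lia.
  by apply/allP; case/andP: l.
- exact: word_of_decreasing rs.
by move=> -> e _; split=> //; rewrite /word_of e size_slid.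
Qed.

Lemma promotion_word la T W : perm_eq (boxes la) W -> sumn la = size W ->
    positive_boxes (boxes la) ->
  linext W -> word_of T W -> word_of (promotion la T) (promote W).
Proof.
case: W => [|h s] p sz pos l r; first by rewrite /word_of.
have [] := slide_from_word p pos l r; rewrite /promotion sz.
case: (slide_from _ _ _) => g T' /= -> r'.
have u : uniq (slid h s ++ [:: hole_end h s]) by rewrite (perm_uniq (perm_slide
  h s)) linext_uniq.
rewrite /word_of map_cat size_cat addn1 size_slid /= /update eqxx.
have -> : rev (iota 1 (size s).+1) = map S (rev (iota 1 (size s))) ++ [:: 1].
  by rewrite [iota 1 _]/= (iotaDl 1 1) rev_cons -map_rev cats1.
congr (_ ++ _); rewrite -(size_slid h) -r' -map_comp;
  apply/eq_in_map => b bs /=.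
case: eqP => // e; move: u; rewrite cat_uniq /= orbF -e bs.
by rewrite andbF.
Qed.

Lemma foldr_maxn l n : n \in l -> (forall i, i \in l -> i <= n) ->
    foldr maxn 0 l = n.
Proof.
move=> nl H; apply/eqP; rewrite eqn_leq; apply/andP; split.
  by elim: l H {nl} => [//|x l IH] H /=;
    rewrite geq_max H ?mem_head // IH // => i il;
    apply: H; rewrite inE il orbT.
elim: l nl {H} => [//|x l IH]; rewrite inE leq_max => /orP[/eqP<-|/IH->];
  rewrite ?leqnn ?orbT //.
Qed.

(** Each round removes the box of the final hole, so the next round works on the
    truncated word [slid h s]. *)
Lemma evacuation_rec_word W k D T F b : perm_eq D W -> positive_boxes D ->
    skew_word W -> word_of T W ->
  evacuation_rec (size W) k D T F b =
    if b \in evac_word W then k + (index b (evac_word W)).+1 else F b.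
Proof.
move: {2 3}(size W) (erefl (size W)) => n;
  elim: n W k D T F => [|n IH] [|h s] k D T F //.
move=> [sz] p pos w r; have [l _] := w.
have max : foldr maxn 0 [seq T b | b <- D] = size (h :: s).
  have [Th _] := word_of_cons r; apply: foldr_maxn.
    by rewrite -[size _]Th map_f // (perm_mem p) mem_head.
  by move=> i; rewrite (perm_mem (perm_map T p)) r mem_rev mem_iota add1n ltnS
    => /andP[].
cbn [evacuation_rec]; rewrite max.
have [] := slide_from_word p pos l r; case: (slide_from _ _ _) => g T' eg r'.
have {eg}-> : g = hole_end h s := eg.
have p' : perm_eq (rem (hole_end h s) D) (slid h s).
  have e : perm_eq D (hole_end h s :: slid h s).
    by rewrite (permPl p) perm_sym -perm_rcons -cats1 perm_slide.
  rewrite -(perm_cons (hole_end h s)) -(permPr e) perm_sym perm_to_rem //.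
  by rewrite (perm_mem e) mem_head.
have pos' : positive_boxes (rem (hole_end h s) D) by move=> c /mem_rem;
  exact: pos.
rewrite (IH _ _ _ _ _ _ p' pos' (skew_word_slid w) r') ?size_slid //.
have u : uniq (evac_word (h :: s)) by rewrite (perm_uniq (perm_evac_word _))
  linext_uniq.
move: u; rewrite evac_word_cons => /andP[nb _].
have -> : index b (hole_end h s :: evac_word (slid h s)) =
  if hole_end h s == b then 0 else (index b (evac_word (slid h s))).+1 by [].
rewrite inE /update; have [->|ne] := eqVneq b (hole_end h s).
  by rewrite (negbTE nb) addn1.
by case: ifP => // _; rewrite addSnnS.
Qed.

Lemma Des_word la T (W : seq box) i : perm_eq (boxes la) W -> word_of T W ->
    0 < i < size W ->
  (i \in Des la T) = nth false (descents W) (size W - i.+1).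
Proof.
move=> p r il.
have l0 : size W - i < size W by lia.
have l1 : size W - i.+1 < size W by lia.
have E0 : size W - (size W - i) = i by lia.
have E1 : size W - (size W - i.+1) = i.+1 by lia.
have E2 : (size W - i.+1).+1 = size W - i by lia.
rewrite (nth_descents (0, 0)) E2 //.
set b0 := nth _ W (size W - i); set b1 := nth _ W (size W - i.+1).
have m0 : b0 \in W by apply: mem_nth.
have m1 : b1 \in W by apply: mem_nth.
have T0 : T b0 = i by rewrite (word_of_nth r l0) E0.
have T1 : T b1 = i.+1 by rewrite (word_of_nth r l1) E1.
rewrite /Des inE; apply/hasP/idP =>
  [[b bb /hasP[b' bb' /and3P[/eqP e /eqP e' lt]]]|lt].
  rewrite !(perm_mem p) in bb bb'.
  have <- : b = b0 by apply: (word_of_inj r) => //; rewrite e T0.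
  by have <- : b' = b1 by apply: (word_of_inj r) => //; rewrite e' T1.
exists b0; first by rewrite (perm_mem p).
apply/hasP; exists b1; first by rewrite (perm_mem p).
by rewrite T0 T1 !eqxx.
Qed.

(** * Staircases and rectangles *)

Lemma mem_staircase k b : (b \in boxes (staircase k)) = in_stair k b.
Proof.
have sz : size (staircase k) = k by rewrite size_map size_iota.
apply/allpairsPdep/idP => [[i [j []]]|].
  rewrite sz !mem_iota => ik; rewrite (nth_map 0) ?size_iota; last lia.
  by rewrite nth_iota; last lia; move=> jk ->; rewrite /in_stair /=; lia.
case: b => i j; rewrite /in_stair /= => ijk; exists i, j.
rewrite sz !mem_iota (nth_map 0) ?size_iota; last lia.
by rewrite nth_iota; last lia; split=> //; lia.
Qed.

Lemma mem_rectangle c r (b : box) :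
  (b \in boxes (rectangle c r)) = [&& 0 < b.1, b.1 <= r, 0 < b.2 & b.2 <= c].
Proof.
apply/allpairsPdep/idP => [[i [j []]]|].
  by rewrite size_nseq !mem_iota nth_nseq => ik; rewrite ifT; last lia;
    move=> jk ->; rewrite /=; lia.
case: b => i j /= ijk; exists i, j.
by rewrite size_nseq !mem_iota nth_nseq ifT; last lia; split=> //; lia.
Qed.

Lemma uniq_boxes la : uniq (boxes la).
Proof.
apply: allpairs_uniq_dep => [|x _|[x1 x2] [y1 y2] _ _ /= [-> ->]] //;
  exact: iota_uniq.
Qed.

Lemma sumn_staircase k : sumn (staircase k) * 2 = k * k.+1.
Proof.
elim: k => [//|k IH]; have -> : staircase k.+1 = k.+1 :: staircase k.
  by rewrite /staircase /= subn0 (iotaDl 1 0) -map_comp; congr cons.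
by rewrite /=; lia.
Qed.

(** A path east and then south from [x] to [y] stays weakly north-west of [y],
    hence in the staircase. *)
Lemma SYT_mono k T (x y : box) : SYT (staircase k) T -> in_stair k x ->
    in_stair k y -> nwle x y ->
  T x <= T y.
Proof.
case=> _ E S; case: x y => [a b] [c d] sx sy; rewrite /nwle /= => /andP[ac bd].
have row n : b + n <= d -> T (a, b) <= T (a, b + n).
  elim: n => [|n IH] l; first by rewrite addn0.
  apply: leq_trans (IH _) _; first lia.
  rewrite addnS ltnW // E // mem_staircase; move: sx sy; rewrite /in_stair /=;
    lia.
have col n : a + n <= c -> T (a, d) <= T (a + n, d).
  elim: n => [|n IH] l; first by rewrite addn0.
  apply: leq_trans (IH _) _; first lia.
  rewrite addnS ltnW // S // mem_staircase; move: sx sy; rewrite /in_stair /=;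
    lia.
have := row (d - b); have := col (c - a); rewrite !subnKC // => h1 h2.
exact: leq_trans (h2 (leqnn _)) (h1 (leqnn _)).
Qed.

Lemma SYT_word k T : SYT (staircase k) T ->
  exists W, [/\ full_word k W, perm_eq (boxes (staircase k)) W,
    sumn (staircase k) = size W & word_of T W].
Proof.
move=> syt; have [pT _ _] := syt; set D := boxes _ in pT *;
  set n := sumn _ in pT.
pose W := [seq box_of D T v | v <- rev (iota 1 n)].
have mT v : v \in rev (iota 1 n) -> v \in [seq T b | b <- D].
  by rewrite mem_rev (perm_mem pT).
have vD v : v \in rev (iota 1 n) -> box_of D T v \in D.
  by move=> /mT vT; rewrite /box_of mem_nth // -(size_map T) index_mem.
have Tv v : v \in rev (iota 1 n) -> T (box_of D T v) = v.
  by move=> /mT vT; rewrite -(nth_map _ 0) ?nth_index // -(size_map T)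
    index_mem.
have sW : size W = n by rewrite size_map size_rev size_iota.
have r : word_of T W.
  by rewrite /word_of sW -map_comp -[RHS]map_id; apply/eq_in_map => v /Tv.
have uW : uniq W by apply: (@map_uniq _ _ T); rewrite r rev_uniq iota_uniq.
have sD : size D = n by rewrite -(size_map T) (perm_size pT) size_iota.
have WD : {subset W <= D} by move=> b /mapP[v /vD + ->].
have p : perm_eq D W.
  rewrite perm_sym; apply: uniq_perm => //; first exact: uniq_boxes.
  by apply: (uniq_min_size uW WD _).2; rewrite sD sW.
exists W; split=> //; split; last by move=> b;
  rewrite -(perm_mem p) mem_staircase.
split.
- have dec := word_of_decreasing r; rewrite pairwise_map in dec.
  suff sub : {in W &, subrel (relpre T gtn) (fun y x : box => ~~ nwle y x)}.
    exact: (sub_in_pairwise sub (allss W) dec).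
  move=> y x yW xW /= lt; apply/negP => yx.
  have := @SYT_mono k T y x syt;
    rewrite -!mem_staircase -/D => /(_ (WD _ yW) (WD _ xW) yx).
  by rewrite leqNgt lt.
- by move=> x /WD; rewrite mem_staircase.
by move=> x y _ iy _; rewrite -(perm_mem p) mem_staircase.
Qed.

(** * The embedded tableau *)

(** The half turn of the rectangle with [k.+1] rows and [k] columns. *)
Definition rotate k (b : box) : box := (k + 2 - b.1, k + 1 - b.2).

Lemma nwcover_rotate k e g : in_stair k e -> in_stair k g ->
    nwcover (rotate k e) (rotate k g) = nwcover g e.
Proof. rewrite /in_stair /nwcover /rotate /=; lia. Qed.

Lemma nwle_rotate k e g : in_stair k e -> in_stair k g ->
    nwle (rotate k e) (rotate k g) = nwle g e.
Proof. rewrite /in_stair /nwle /rotate /=; lia. Qed.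

Lemma rotateK k b : in_stair k b -> rotate k (rotate k b) = b.
Proof. by rewrite /in_stair => i; apply: box_eqP; rewrite /rotate /=; lia. Qed.

(** The half turn reverses adjacency, so the hole sliding through the rotated
    evacuation moves like the letter that [displace] carries along. *)
Lemma hole_end_rotate k g E : in_stair k g -> (forall e : box, e \in E ->
    in_stair k e) ->
  hole_end (rotate k g) (map (rotate k) E) = rotate k (foldl displace g E).
Proof.
elim: E g => [//|e E IH] g ig iE; have ie := iE e (mem_head _ _).
have iE' x : x \in E -> in_stair k x by move=> xE; apply: iE;
  rewrite inE xE orbT.
rewrite /= nwcover_rotate // /displace; case: ifP => _; exact: IH.
Qed.

Lemma descents_last_cat (u v : seq box) : 1 < size v ->
  last false (descents (u ++ v)) = last false (descents v).
Proof.
case/lastP: v => [//|v o]; case/lastP: v => [//|v g] _.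
by rewrite -!cats1 -!catA catA !descents_last.
Qed.

Lemma evac_word_increasing W : skew_word W ->
    pairwise (fun y x : box => ~~ nwle x y) (evac_word W).
Proof.
move: {2}(size W) (erefl (size W)) => n; elim: n W => [|n IH] [|h s] // [e] w.
rewrite evac_word_cons /= IH ?size_slid ?andbT //; last exact: skew_word_slid.
have [l _] := skew_word_slide w; apply/allP => x;
  rewrite (perm_mem (perm_evac_word _)) => xs.
move: l; rewrite linext_cat => /and3P[/allrelP/(_ x (hole_end h s) xs) + _ _].
by apply; rewrite mem_head.
Qed.

(** The word of the embedded tableau: the complemented entries come first, by
    decreasing value, in the rotated boxes of the evacuation. *)
Definition rect_word k W : seq box := map (rotate k) (evac_word W) ++ W.

Lemma full_word_positive k W (D : seq box) : full_word k W -> perm_eq D W ->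
    positive_boxes D.
Proof.
by move=> [[_ sc _] _] p b; rewrite (perm_mem p) => /sc /and3P[-> -> _].
Qed.

Lemma evac_word_in_stair k W (b : box) : full_word k W ->
    b \in evac_word W -> in_stair k b.
Proof. by move=> [[_ sc _] _]; rewrite (perm_mem (perm_evac_word W));
  exact: sc. Qed.

Lemma size_rect_word k W : size (rect_word k W) = size W + size W.
Proof. by rewrite size_cat size_map size_evac_word. Qed.

Lemma linext_rect_word k W : full_word k W -> linext (rect_word k W).
Proof.
move=> f; have [w _] := f; have [l sc _] := w.
rewrite linext_cat l andbT; apply/andP; split.
  apply/allrelP => y x /mapP[e /(evac_word_in_stair f) ie ->] /sc; move: ie.
  by rewrite /nwle /rotate /in_stair /=; lia.
rewrite /linext pairwise_map.
have sub : {in evac_word W &, subrel (fun y x : box => ~~ nwle x y)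
                               (relpre (rotate k) (fun y x : box =>
                                 ~~ nwle y x))}.
  by move=> y x /(evac_word_in_stair f) iy /(evac_word_in_stair f) ix;
    rewrite /= nwle_rotate.
exact: (sub_in_pairwise sub (allss _) (evac_word_increasing (stair_word_skew
  w))).
Qed.

Lemma mem_rect_word k W (b : box) : full_word k W ->
  (b \in rect_word k W) = [&& 0 < b.1, b.1 <= k.+1, 0 < b.2 & b.2 <= k].
Proof.
move=> f; have [[_ sc _] fl] := f; rewrite mem_cat; apply/idP/idP.
  case/orP=> [/mapP[e /(evac_word_in_stair f) + ->]|/sc];
    rewrite /rotate /in_stair /=; lia.
move=> ib; case: (leqP (b.1 + b.2) k.+1) => sb; apply/orP.
  by right; apply: fl; move: ib sb; rewrite /in_stair; lia.
left; have ir : in_stair k (rotate k b) by move: ib sb;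
  rewrite /rotate /in_stair /=; lia.
have -> : b = rotate k (rotate k b) by apply: box_eqP; move: ib;
  rewrite /rotate /=; lia.
by apply: map_f; rewrite (perm_mem (perm_evac_word W)); exact: fl.
Qed.

Lemma perm_rect_word k W : full_word k W ->
    perm_eq (boxes (rectangle k k.+1)) (rect_word k W).
Proof.
move=> f; apply: uniq_perm;
  [exact: uniq_boxes | exact/linext_uniq/linext_rect_word |].
by move=> b; rewrite mem_rectangle mem_rect_word.
Qed.

Lemma evacuation_word k S W (b : box) : full_word k W ->
    perm_eq (boxes (staircase k)) W ->
    sumn (staircase k) = size W -> word_of S W -> b \in evac_word W ->
  evacuation (staircase k) S b = (index b (evac_word W)).+1.
Proof.
move=> f p sz r bE; rewrite /evacuation sz.
by rewrite (evacuation_rec_word 0 _ _ p (full_word_positive f p)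
  (stair_word_skew (proj1 f)) r) bE.
Qed.

Lemma rect_word_of k S W : full_word k W -> perm_eq (boxes (staircase k)) W ->
  sumn (staircase k) = size W -> word_of S W ->
    word_of (embedding k S) (rect_word k W).
Proof.
move=> f p sz r; have [w _] := f; have [_ sc _] := w.
have N : k * (k + 1) = size W + size W by have := sumn_staircase k;
  rewrite sz; lia.
apply: nth_word_of => j; rewrite size_rect_word => jl;
  rewrite nth_cat size_map size_evac_word.
case: ltnP => jn; last first.
  have l2 : j - size W < size W by lia.
  have e2 : size W - (j - size W) = size W + size W - j by lia.
  rewrite -e2 -(word_of_nth r l2).
  set b := nth _ W _; have ib : in_stair k b by apply: sc; apply: mem_nth.
  move: ib; rewrite /in_stair /embedding; case: b => b1 b2 /= ib.
  by rewrite ifT //; lia.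
rewrite (nth_map (0, 0)) ?size_evac_word //; set e := nth _ _ _.
have eE : e \in evac_word W by apply: mem_nth; rewrite size_evac_word.
have ie := evac_word_in_stair f eE; rewrite /embedding /rotate ifF; last first.
  by move: ie; rewrite /in_stair; clear; lia.
have := rotateK ie; rewrite {1}/rotate /= => ->;
  rewrite (evacuation_word f p sz r eE).
rewrite index_uniq ?size_evac_word //; first by rewrite N; lia.
by rewrite (perm_uniq (perm_evac_word _)) linext_uniq; case: w.
Qed.

(** The slide leaves the rotated part at the image of the corner reached by the
    entry 1 of the promotion.  By [corner_transpose] this is the box just south of
    the largest entry [h] of [W]; the hole moves there, and from then on the slide
    is that of [W]. *)
Lemma promote_rect_word k W : 1 < k -> full_word k W -> 
  last false (descents (promote (rect_word k W))) =
    last false (descents (promote W)).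
Proof.
move=> k1 f; case: W f => [|h s] f; first by [].
have [w _] := f; have [s1 es] := full_word_last k1 f.
have iE (e : box) : e \in evac_word (slid h s) -> in_stair k e.
  by move=> eE; apply: (evac_word_in_stair f);
    rewrite evac_word_cons inE eE orbT.
have ig : in_stair k (hole_end h s) by apply: (evac_word_in_stair f);
  rewrite evac_word_cons mem_head.
rewrite /rect_word evac_word_cons map_cons cat_cons [promote _]/=.
rewrite slid_cat hole_end_cat (hole_end_rotate ig iE).
set q := foldl _ _ _.
have q1 : q.1 + h.1 = k.+1 := corner_transpose k1 f.
have q2 : q.1 + q.2 = k.+1 := first_letter_corner (stair_word_slide w).
have hc := head_corner w.
have c : nwcover h (rotate k q) by rewrite /nwcover /rotate /=; lia.
rewrite [slid (rotate k q) _]/= [hole_end (rotate k q) _]/= c.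
rewrite -catA cat_cons -cat_rcons descents_last_cat // size_cat size_slid es
  size_cat /=; lia.
Qed.

Lemma perm_promote W : perm_eq W (promote W).
Proof. by case: W => // h s; rewrite perm_sym; exact: perm_slide. Qed.

Lemma Des_promotion la T W : perm_eq (boxes la) W -> sumn la = size W ->
    positive_boxes (boxes la) -> linext W -> word_of T W -> 1 < size W ->
  (1 \in Des la (promotion la T)) = last false (descents (promote W)).
Proof.
move=> p sz pos l r W1; have r' := promotion_word p sz pos l r.
have sp : size (promote W) = size W by rewrite -(perm_size (perm_promote W)).
rewrite (Des_word (perm_trans p (perm_promote W)) r') sp //.
by rewrite -nth_last size_descents sp subn2.
Qed.

(** Both sides compare the corner reached by the entry 1 of the promotion with
    the last box of the evacuation: the left side by [first_letter_descent], the
    right one by [corner_transpose], which expresses the former through [h]. *)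
Lemma promote_descent k h s : 1 < k -> full_word k (h :: s) ->
  last false (descents (promote (h :: s))) =
    ((rotate k (last (0, 0) (evac_word (h :: s)))).1 <= h.1).
Proof.
move=> k1 f; have [s1 es] := full_word_last k1 f;
  have [fp _] := full_word_promote f.
rewrite [promote _]/= -(first_letter_descent fp);
  last by rewrite size_slid es size_cat addn1.
rewrite evac_word_cons [last (0, 0) _]/=; set e := last _ _.
have : in_stair k e by apply: (evac_word_in_stair f); rewrite evac_word_cons;
  exact: mem_last.
have := corner_transpose k1 f; rewrite [first_letter_end _]/=;
  set q := foldl _ _ _.
by rewrite /in_stair /rotate /=; lia.
Qed.

Theorem theorem4p11 (k : nat) (S : filling) :
  2 < k -> SYT (staircase k) S ->
  stair_descent_vector k S = rect_descent_vector k k.+1 (embedding k S).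
Proof.
move=> k2 syt; have [W [f p sz r]] := SYT_word syt.
have k1 : 1 < k by apply: ltnW.
have [w _] := f; have [l sc _] := w.
set n := size W in sz.
have nN : k * k.+1 = 2 * n by rewrite -sumn_staircase sz mulnC.
have n1 : 1 < n by nia.
have pr := perm_rect_word f; have rr := rect_word_of f p sz r.
set o : box := (0, 0).
have sR : size (rect_word k W) = 2 * n by rewrite size_rect_word mul2n addnn.
have DS j : 0 < j < n -> (j \in Des (staircase k) S) =
    ((nth o W (n - j)).1 < (nth o W (n - j.+1)).1).
  move=> jn; rewrite (Des_word p r) // (nth_descents o) -/n; last by lia.
  by have -> : (n - j.+1).+1 = n - j by lia.
have DR j : 0 < j < 2 * n -> (j \in Des (rectangle k k.+1) (embedding k S)) =
    ((nth o (rect_word k W) (2 * n - j)).1 < (nth o (rect_word k W) (2 * n -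
      j.+1)).1).
  move=> jn; rewrite (Des_word pr rr) sR // (nth_descents o) ?sR; last by lia.
  by have -> : (2 * n - j.+1).+1 = 2 * n - j by lia.
have DP := Des_promotion p sz (full_word_positive f p) l r n1.
have DRP : (1 \in Des (rectangle k k.+1) (promotion (rectangle k k.+1)
  (embedding k S)))
    = last false (descents (promote W)).
  rewrite -(promote_rect_word k1 f); apply: Des_promotion rr _ => //.
  - by rewrite sumn_nseq sR.
  - by move=> b; rewrite mem_rectangle => /and4P[-> _ ->].
  - exact: linext_rect_word.
  - by rewrite sR; lia.
have RE j : j < n -> nth o (rect_word k W) j = rotate k (nth o (evac_word W) j).
  by move=> jn; rewrite nth_cat size_map size_evac_word jn (nth_map o) //
    size_evac_word.
have RW j : nth o (rect_word k W) (n + j) = nth o W j.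
  by rewrite nth_cat size_map size_evac_word -/n ltnNge leq_addr addKn.
rewrite /stair_descent_vector /rect_descent_vector addn1 nN mulKn //.
apply/eq_in_map => i; rewrite mem_iota => il.
case: (ltngtP i n) => [lt|gt|->].
- rewrite ifT; last by lia.
  rewrite DS ?DR; [|lia|lia].
  have -> : 2 * n - i = n + (n - i) by lia.
  have -> : 2 * n - i.+1 = n + (n - i.+1) by lia.
  by rewrite !RW.
- case: ltnP => i2; last by rewrite DP DRP.
  (* position in W of the entry i - n + 1, and in E of the entry n - (i - n) *)
  set j := n - (i - n).+1.
  rewrite DS ?DR; [|lia|lia].
  have -> : n - (i - n) = j.+1 by rewrite /j; lia.
  have -> : 2 * n - i = j.+1 by rewrite /j; lia.
  have -> : 2 * n - i.+1 = j by rewrite /j; lia.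
  have jn : j.+1 < n by rewrite /j; lia.
  rewrite !RE // ?(ltnW jn) // -(evac_word_descents o w jn).
  have ins m : m < n -> in_stair k (nth o (evac_word W) m).
    by move=> mn; apply: (evac_word_in_stair f); apply: mem_nth;
      rewrite size_evac_word.
  have := ins j (ltnW jn); have := ins j.+1 jn.
  move: (nth o _ j) (nth o _ j.+1) => a b; rewrite /in_stair /rotate /=;
    clear; lia.
rewrite ifT; last by lia.
rewrite DP DR; last by lia.
have -> : 2 * n - n = n + 0 by lia.
have -> : 2 * n - n.+1 = n.-1 by lia.
rewrite RW RE; last by lia.
rewrite -[n.-1]/((size W).-1) -(size_evac_word W) nth_last.
have W0 : 0 < size W := ltnW n1.
case: (W) f W0 => [//|h s] f _.
by rewrite (promote_descent k1 f) -ltnNge.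
Qed.
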